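(* Let $\{(T^n,S^n)\}_{n=0}^\infty$ be a nested triangulation of a polyhedral pair $(X,A)$ in $\mathbb{R}^d$, and let $(L_n)_{n=0}^\infty$ be a sequence of positive real numbers with $\sum_{n=0}^\infty L_n=L<\infty$. Let $V=\bigcup_{n=0}^\infty V^{(n)}$ be the set of all vertices of these triangulations that are not in $A$, and let $\mathbb{B}=\{\mathcal{K}_v \mid v\in V\}$ be the associated set of functionals on $(X,A)$, with Lipschitz constants $(L_n)_{n=0}^\infty$. Then there exists an ordering of $\mathbb{B}$ such that $\mathbb{B}$ is a Schauder basis of $\mathrm{Lip}_c(X,A)$ equipped with the $\ell^\infty$ (supremum) norm.
   Context: A polyhedron $X\subset\mathbb{R}^d$ is a finite intersection of closed half-spaces. A polyhedral pair $(X,A)$ consists of a polyhedron $X$ and a nonempty proper subset $A\subsetneq X$ that is a finite union of sub-polyhedra of $X$. $X$ carries the Euclidean metric. A map from the geometric realization of a simplicial complex $T$ to a real vector space is piecewise linear (p.l.) on $T$ if its value at a point $\sum_i a_i v_i$ (barycentric coordinates in a simplex $\langle v_0,\dots,v_p\rangle$ of $T$) is $\sum_i a_i f(v_i)$. A p.l. triangulation of $(X,A)$ is a simplicial complex $T$ with a subcomplex $S$, together with a homeomorphism of pairs $(|T|,|S|)\to(X,A)$ that is p.l. on $T$; the homeomorphism is suppressed, so simplices of $T$ are viewed as subsets of $X$, and a function $f:X\to\mathbb{R}$ is called p.l. on $T$ if its composite with the homeomorphism is. A nested triangulation of $(X,A)$ is a sequence $\{(T^n,S^n)\}_{n\ge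 0}$ such that each $(T^n,S^n)$ is a p.l. triangulation of $(X,A)$, each $T^{n+1}$ is a refinement of $T^n$ (every simplex of $T^{n+1}$ is contained in a simplex of $T^n$), and $\sup_{\sigma\in T^n}\mathrm{diam}(\sigma)\to 0$ as $n\to\infty$. A function on $X$ is $n$-linear if it is p.l. on $T^n$. $V^n$ is the set of vertices of $T^n$ that are not vertices of $S^n$; $V^{(n)}=V^n\setminus V^{n-1}$ (with $V^{-1}=\emptyset$). For $v\in V^{(n)}$, $\mathcal{K}_v:X\to\mathbb{R}$ is the unique function that vanishes on $A$, is $n$-linear, satisfies $\mathcal{K}_v(v')=0$ for all $v'\in V^n$ with $v'\ne v$, has $\mathcal{K}_v(v)>0$, and has (best) Lipschitz constant $\mathrm{Lip}(\mathcal{K}_v)=L_n$. $\mathrm{Lip}_c(X,A)$ is the vector space of compactly supported Lipschitz functions $X\to\mathbb{R}$ vanishing on $A$. A Schauder basis of a topological vector space $W$ over a field $\mathbb{F}$ is a countable subset $\{e_i\}_{i=0}^\infty\subset W$ such that for every $w\in W$ there is a unique sequence of scalars $(a_i)_{i=0}^\infty$ in $\mathbb{F}$ such that the partial sums of $\sum_{i=0}^\infty a_ie_i$ converge to $w$. *)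

(* Defs.v *)
From HB Require Import structures.
From mathcomp Require Import all_boot all_order all_algebra.
From mathcomp Require Import finmap.
From mathcomp Require Import all_classical all_reals all_analysis.

Set Implicit Arguments.
Unset Strict Implicit.
Unset Printing Implicit Defensive.

Import Order.TTheory GRing.Theory Num.Theory.
Import numFieldNormedType.Exports.

Local Open Scope classical_set_scope.
Local Open Scope ring_scope.

Section Polyhedra.
Context {R : realType} {d : nat}.
Implicit Types (X A : set 'rV[R]_d) (x y : 'rV[R]_d).

(* The library norm of 'rV is the sup norm, so the Euclidean distance is
   spelled out; both induce the same topology. *)
Definition eucl_dist x y : R := Num.sqrt (\sum_i (x 0 i - y 0 i) ^+ 2).

Definition halfspace (a : 'rV[R]_d) (b : R) : set 'rV[R]_d :=
  [set x | \sum_i a 0 i * x 0 i <= b].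

Definition polyhedron X : Prop :=
  exists m (a : 'I_m -> 'rV[R]_d) (b : 'I_m -> R),
    (forall i, a i != 0) /\ X = \bigcap_i halfspace (a i) (b i).

Definition polyhedral_pair X A : Prop :=
  [/\ polyhedron X, A !=set0, A `<` X
    & exists m (P : 'I_m -> set 'rV[R]_d),
        (forall i, polyhedron (P i) /\ P i `<=` X) /\ A = \bigcup_i P i].

End Polyhedra.

Record simplicialComplex := SimplicialComplex {
  vertex : choiceType;
  face : set {fset vertex};
  face_neq0 : forall s, face s -> s != fset0;
  face_sub : forall s t, face s -> t != fset0 -> (t `<=` s)%fset -> face t;
  face1 : forall v : vertex, face [fset v]%fset }.

(* A subcomplex need not contain every vertex of T. *)
Definition subcomplex (T : simplicialComplex) (S : set {fset vertex T}) : Prop :=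
  S `<=` @face T /\
  forall s t, S s -> t != fset0 -> (t `<=` s)%fset -> S t.

Section Realization.
Context (R : realType) (T : simplicialComplex).

Definition barycentric (s : {fset vertex T}) : set (vertex T -> R) :=
  [set a | [/\ forall v, 0 <= a v, forall v, v \notin s -> a v = 0
             & \sum_(v <- s) a v = 1]].

Definition realization : Type :=
  set_type [set a | exists2 s, face s & barycentric s a].

HB.instance Definition _ := Choice.on realization.

Definition coords (p : realization) : vertex T -> R := set_val p.

Definition closed_simplex (s : {fset vertex T}) : set realization :=
  [set p | barycentric s (coords p)].

Definition subrealization (S : set {fset vertex T}) : set realization :=
  \bigcup_(s in S) closed_simplex s.

(* The coherent (weak) topology: U is open iff its trace on every closed
   simplex is open there.  The pointwise topology on coordinates induces the
   Euclidean topology on each simplex. *)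
Definition weak_open (U : set realization) : Prop :=
  forall s, face s -> exists2 W : set {ptws vertex T -> R}, open W &
    forall p, closed_simplex s p -> (U p <-> W (coords p)).

Lemma weak_openT : weak_open setT.
Proof. by move=> s _; exists setT => //; exact: openT. Qed.

Lemma weak_openI : setI_closed weak_open.
Proof.
move=> U V oU oV s fs; have [W1 oW1 h1] := oU s fs; have [W2 oW2 h2] := oV s fs.
exists (W1 `&` W2); first exact: openI.
by move=> p sp; split=> -[? ?]; split; [exact/h1|exact/h2|exact/h1|exact/h2].
Qed.

Lemma weak_open_bigU (I : Type) (F : I -> set realization) :
  (forall i, weak_open (F i)) -> weak_open (\bigcup_i F i).
Proof.
move=> oF s fs.
exists (\bigcup_(W in [set W : set {ptws vertex T -> R} | open W /\
   exists i, forall p, closed_simplex s p -> (F i p <-> W (coords p))]) W).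
  by apply: bigcup_open => W [].
move=> p sp; split.
  move=> [i _ Fip]; have [W oW hW] := oF i s fs.
  by exists W; [split=> //; exists i|exact/hW].
by move=> [W [_ [i hW]] Wp]; exists i => //; exact/hW.
Qed.

HB.instance Definition _ := isOpenTopological.Build realization
  weak_openT weak_openI weak_open_bigU.

Definition vertex_coords (v : vertex T) : vertex T -> R := fun w => (w == v)%:R.

Lemma vertex_coordsP v :
  vertex_coords v \in [set a | exists2 s, face s & barycentric s a].
Proof.
apply/mem_set; exists [fset v]%fset; first exact: face1.
split=> [w|w|]; rewrite /vertex_coords ?ler0n //.
  by rewrite inE => /negbTE ->.
by rewrite big_seq_fset1 eqxx.
Qed.

Definition vertex_point (v : vertex T) : realization :=
  exist _ (vertex_coords v) (vertex_coordsP v).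

Definition pl_on (V : lmodType R) (g : realization -> V) : Prop :=
  forall s, face s -> forall p, closed_simplex s p ->
    g p = \sum_(v <- s) coords p v *: g (vertex_point v).

End Realization.

Definition homeomorphism (Y Z : topologicalType) (h : Y -> Z) : Prop :=
  exists g : Z -> Y, [/\ cancel h g, cancel g h, continuous h & continuous g].

(* X coerces to the subtype of its points, with the subspace topology. *)
Record plTriangulation (R : realType) (d : nat) (X A : set 'rV[R]_d) :=
  PLTriangulation {
    cplx : simplicialComplex;
    subcplx : set {fset vertex cplx};
    subcplxP : subcomplex subcplx;
    real_map : realization R cplx -> X;
    real_map_homeo : homeomorphism real_map;
    real_map_sub : (set_val \o real_map) @` subrealization subcplx = A;
    real_map_pl : pl_on (set_val \o real_map) }.

Arguments real_map {R d X A} p.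

Section NestedTriangulations.
Context {R : realType} {d : nat} {X A : set 'rV[R]_d}.
Implicit Types (T : plTriangulation X A).

Definition simplex T (s : {fset vertex (cplx T)}) : set X :=
  real_map T @` closed_simplex s.

Definition refines T' T : Prop :=
  forall s' : {fset vertex (cplx T')}, face s' ->
    exists2 s : {fset vertex (cplx T)}, face s & simplex s' `<=` simplex s.

Definition eucl_diam (B : set X) : \bar R :=
  ereal_sup [set (eucl_dist (set_val z.1) (set_val z.2))%:E | z in B `*` B].

Definition mesh T : \bar R :=
  ereal_sup [set eucl_diam (simplex s) | s in @face (cplx T)].

Definition nested_triangulation (T : nat -> plTriangulation X A) : Prop :=
  (forall n, refines (T n.+1) (T n)) /\ mesh (T n) @[n --> \oo] --> 0%E.

Definition linear_on T (f : X -> R) : Prop :=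
  pl_on ((f : X -> R^o) \o real_map T).

Definition lipschitz_with (k : R) (f : X -> R) : Prop :=
  forall x y : X, `|f x - f y| <= k * eucl_dist (set_val x) (set_val y).

(* Best Lipschitz constant; +oo when f is not Lipschitz. *)
Definition Lip (f : X -> R) : \bar R :=
  ereal_inf [set k%:E | k in [set k : R | 0 <= k /\ lipschitz_with k f]].

Definition free_vertices T : set X :=
  [set real_map T (vertex_point R v) | v in
    [set v : vertex (cplx T) | ~ subcplx [fset v]%fset]].

Definition new_vertices (T : nat -> plTriangulation X A) (n : nat) : set X :=
  if n is m.+1 then free_vertices (T m.+1) `\` free_vertices (T m)
  else free_vertices (T 0%N).

Definition vanishes_on_A (f : X -> R) : Prop :=
  forall x : X, A (set_val x) -> f x = 0.

Definition is_kernel (T : nat -> plTriangulation X A) (L : nat -> R)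
    (n : nat) (v : X) (f : X -> R) : Prop :=
  [/\ vanishes_on_A f, linear_on (T n) f,
      forall v', free_vertices (T n) v' -> v' <> v -> f v' = 0,
      0 < f v
    & Lip f = (L n)%:E].

(* The functions K_v, v in the union of the V^(n). *)
Definition kernels (T : nat -> plTriangulation X A) (L : nat -> R) :
    set (X -> R) :=
  [set f | exists n, exists2 v, new_vertices T n v & is_kernel T L n v f].

End NestedTriangulations.

Section Lipc.
Context {R : realType} {d : nat} (X A : set 'rV[R]_d).

Definition compactly_supported (f : X -> R) : Prop :=
  compact (closure [set x : X | f x != 0]).

Definition lipc_prop (f : X -> R^o) : Prop :=
  [/\ exists k, lipschitz_with k f, compactly_supported f
    & vanishes_on_A (A:=A) f].

Definition lipc_pred : {pred (X -> R^o)} := fun f => `[< lipc_prop f >].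

Lemma compactly_supported_sub (f : X -> R) (K : set X) :
  compact K -> closed K -> (forall x, f x != 0 -> K x) -> compactly_supported f.
Proof.
move=> cK clK fK; apply: (subclosed_compact _ cK); first exact: closed_closure.
by rewrite [X in _ `<=` X](closure_id K).1//; apply: closure_subset.
Qed.

Lemma lipc_submod_closed : submod_closed lipc_pred.
Proof.
split.
  apply/asboolP; split=> //.
    by exists 0 => x y; rewrite subrr normr0 mul0r.
  by apply: (compactly_supported_sub compact0 closed0) => x /=; rewrite eqxx.
move=> a f g /asboolP[[k hk] cf vf] /asboolP[[k' hk'] cg vg]; apply/asboolP.
split.
- exists (`|a| * k + k') => x y.
  have -> : (a *: f + g) x - (a *: f + g) y = a * (f x - f y) + (g x - g y).
    by rewrite /= mulrBr opprD addrACA.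
  rewrite mulrDl (le_trans (ler_normD _ _))// lerD// normrM -mulrA.
  exact: ler_wpM2l.
- have := compactU cf cg; move/compactly_supported_sub; apply.
    by apply: closedU; exact: closed_closure.
  move=> x /= fgx; have [fx0|fx0] := eqVneq (f x) 0; last first.
    by left; exact: subset_closure.
  right; apply: subset_closure => /=; move: fgx.
  have -> : (a *: f + g) x = a * f x + g x by [].
  by rewrite fx0 mulr0 add0r.
- move=> x Ax; have -> : (a *: f + g) x = a * f x + g x by [].
  by rewrite vf// vg// mulr0 add0r.
Qed.

HB.instance Definition _ :=
  GRing.isSubmodClosed.Build R (X -> R^o) lipc_pred lipc_submod_closed.

Record lipc := MkLipc {
  lipc_fun : X -> R^o;
  lipc_funP : lipc_fun \in lipc_pred }.

HB.instance Definition _ := [isSub for lipc_fun].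
HB.instance Definition _ := [Choice of lipc by <:].
HB.instance Definition _ := [SubChoice_isSubLmodule of lipc by <:].

Definition sup_norm (f : lipc) : R := sup (range (fun x => `|lipc_fun f x|)).

Lemma eucl_dist_le (x y : 'rV[R]_d) (M : R) : (forall i, `|x 0 i - y 0 i| <= M) ->
  eucl_dist x y <= Num.sqrt (\sum_(i < d) M ^+ 2).
Proof.
move=> h; apply: ler_wsqrtr; apply: ler_sum => i _.
by rewrite -[X in X <= _]real_normK ?num_real// lerXn2r// nnegrE ?(le_trans _ (h i)).
Qed.

Lemma lipc_bounded (f : lipc) : exists M, forall x, `|lipc_fun f x| <= M.
Proof.
case: f => f /= /asboolP[[k hk] cf _].
have [f0|] := pselect (forall x, f x = 0).
  by exists 0 => x; rewrite f0 normr0.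
move=> /existsNP[x0 /eqP fx0].
have /compact_bounded[M [_ MK]] : compact (set_val @` closure [set x : X | f x != 0]).
  apply: continuous_compact cf; apply: continuous_subspaceT.
  exact: initial_continuous.
have coord x i : f x != 0 -> `|set_val x 0 i| <= `|M| + 1.
  move=> fx; have /(MK (`|M| + 1)) h : M < `|M| + 1.
    by rewrite (le_lt_trans (ler_norm M))// ltrDl.
  apply: le_trans (h (set_val x) _); last first.
    by exists x => //; exact: subset_closure.
  by rewrite [leRHS]/Num.norm /= mx_normrE; apply/bigmax_geP; right => /=; exists (0, i).
pose D := Num.sqrt (\sum_(i < d) ((`|M| + 1) + (`|M| + 1)) ^+ 2).
exists (`|f x0| + `|k| * D) => x.
have [->|fx] := eqVneq (f x) 0.
  by rewrite normr0 addr_ge0// mulr_ge0// sqrtr_ge0.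
rewrite -[f x](subrK (f x0)) (le_trans (ler_normD _ _))// addrC lerD2l.
apply: (le_trans (hk _ _)).
rewrite (@le_trans _ _ (`|k| * eucl_dist (set_val x) (set_val x0)))//.
  by rewrite ler_wpM2r ?sqrtr_ge0// ler_norm.
apply: ler_wpM2l => //; apply: eucl_dist_le => i.
by rewrite (le_trans (ler_normB _ _))// lerD// coord//; exact/eqP.
Qed.

Lemma sup_normP (f : lipc) x : `|lipc_fun f x| <= sup_norm f.
Proof.
have [M hM] := lipc_bounded f; apply: ub_le_sup; last by exists x.
by exists M => _ [y _ <-].
Qed.

Lemma sup_norm_empty (f : lipc) : ~ (exists x : X, True) -> sup_norm f = 0.
Proof.
move=> nX; rewrite -[RHS](@sup0 R); congr sup.
by apply/seteqP; split=> // z [y _ _]; case: nX; exists y.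
Qed.

Lemma sup_norm_le (f : lipc) M :
  0 <= M -> (forall x, `|lipc_fun f x| <= M) -> sup_norm f <= M.
Proof.
move=> M0 h; have [[x _]|] := pselect (exists x : X, True).
  by apply: ge_sup; [exists `|lipc_fun f x|; exists x|move=> _ [y _ <-]].
by move=> nX; rewrite sup_norm_empty.
Qed.

Lemma sup_norm_ge0 (f : lipc) : 0 <= sup_norm f.
Proof.
have [[x _]|nX] := pselect (exists x : X, True).
  exact: le_trans (sup_normP f x).
by rewrite sup_norm_empty.
Qed.

Lemma sup_normD (f g : lipc) : sup_norm (f + g) <= sup_norm f + sup_norm g.
Proof.
apply: sup_norm_le => [|x]; first by rewrite addr_ge0// sup_norm_ge0.
by rewrite (le_trans (ler_normD _ _))// lerD// sup_normP.
Qed.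

Lemma sup_normZ (a : R) (f : lipc) : sup_norm (a *: f) = `|a| * sup_norm f.
Proof.
have le b g : sup_norm (b *: g) <= `|b| * sup_norm g.
  apply: sup_norm_le => [|x]; first by rewrite mulr_ge0// sup_norm_ge0.
  by rewrite [X in `|X|](_ : _ = b * lipc_fun g x)// normrM ler_wpM2l// sup_normP.
have [->|a0] := eqVneq a 0.
  apply/le_anti/andP; split; first exact: le.
  by rewrite normr0 mul0r sup_norm_ge0.
apply/le_anti; rewrite le/= -ler_pdivlMl ?normr_gt0// -normfV.
by rewrite -{1}[f](scalerK a0) le.
Qed.

Lemma sup_norm_eq0 (f : lipc) : sup_norm f = 0 -> f = 0.
Proof.
move=> f0; apply: val_inj; apply/funext => x /=; apply/eqP.
by rewrite -normr_le0 -f0 sup_normP.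
Qed.

HB.instance Definition _ :=
  Lmodule_isNormed.Build R lipc sup_normD sup_normZ sup_norm_eq0.

End Lipc.

Arguments lipc_fun {R d X A} l.

Definition schauder_basis (K : numFieldType) (W : TopologicalLmodule.type K)
    (e : nat -> W) : Prop :=
  forall w : W, exists! a : nat -> K, [series a i *: e i]_i @ \oo --> w.

(* Main.v *)
(**
For a vertex v of level n, i.e. v in V^(n), the kernel K_v is a positive
multiple of the hat function of v, its barycentric coordinate with respect to
T^n.  Hat functions are Lipschitz because v lies in finitely many simplices, on
each of which barycentric coordinates are affine, and X is convex; so the
normalisation Lip K_v = L_n can be achieved in exactly one way.

Let I_n f be the n-linear interpolation of f at the vertices of T^n, with
I_(-1) f = 0.  As V^n is increasing and every k-linear function is n-linear for
k <= n, the difference I_n f - I_(n-1) f is the combination of the hats of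
level n with coefficients f(v) - I_(n-1) f(v), and I_n f -> f uniformly for
Lipschitz f, since the mesh tends to 0.  A level can be infinite, so V is
enumerated by increasing max(level v, floor |v|): for a compactly supported f,
the partial sums are then eventually of the form I_N f plus part of level N+1,
which is also small.  Uniqueness follows by induction on the level, because
a hat vanishes at all other vertices of its own and of lower levels.
*)

Require Import Defs.
From HB Require Import structures.
From mathcomp Require Import all_boot all_order all_algebra.
From mathcomp Require Import finmap.
From mathcomp Require Import all_classical all_reals all_analysis.
From mathcomp Require Import ring lra.

Import Order.TTheory GRing.Theory Num.Theory.
Import numFieldNormedType.Exports.

Local Open Scope classical_set_scope.
Local Open Scope ring_scope.

Set Implicit Arguments.
Unset Strict Implicit.
Unset Printing Implicit Defensive.

(** * Barycentric coordinates, interpolation and hat functions of a single triangulation *)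

Section BarycentricCoordinates.
Context {R : realType} {d : nat} {X A : set 'rV[R]_d}.
Variable T : plTriangulation X A.
Local Notation vtx := (vertex (cplx T)).
Implicit Types (x y : X) (s t : {fset vtx}) (v w : vtx) (f g : X -> R).

Definition real_map_inv : X -> realization R (cplx T) :=
  projT1 (cid (real_map_homeo T)).

Lemma real_map_invP : [/\ cancel (real_map T) real_map_inv,
  cancel real_map_inv (real_map T), continuous (real_map T) &
  continuous real_map_inv].
Proof. by rewrite /real_map_inv; case: cid. Qed.

Lemma real_mapK : cancel (real_map T) real_map_inv.
Proof. by have [] := real_map_invP. Qed.

Lemma real_map_invK : cancel real_map_inv (real_map T).
Proof. by have [] := real_map_invP. Qed.

Definition bc x : vtx -> R := coords (real_map_inv x).

Definition pt v : X := real_map T (vertex_point R v).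

Lemma bc_face x : exists2 s, face s & barycentric s (bc x).
Proof. by rewrite /bc; case: (real_map_inv x) => a ha; exact: (set_mem ha). Qed.

(** Some face whose closed simplex contains [x], not necessarily the smallest one: coordinates may
    vanish at some of its vertices. *)
Definition carrier x : {fset vtx} := projT1 (cid2 (bc_face x)).

Lemma carrier_face x : face (carrier x).
Proof. by rewrite /carrier; case: cid2. Qed.

Lemma carrierP x : barycentric (carrier x) (bc x).
Proof. by rewrite /carrier; case: cid2. Qed.

Lemma bc_ge0 x v : 0 <= bc x v.
Proof. by have [] := carrierP x. Qed.

Lemma bc_neq0_carrier x v : bc x v != 0 -> v \in carrier x.
Proof.
by have [_ h _] := carrierP x; apply: contraR => /h ->.
Qed.

Lemma sum_bc x (s : {fset vtx}) : {subset carrier x <= s} ->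
  \sum_(v <- s) bc x v = 1.
Proof.
move=> cs; have [_ h <-] := carrierP x.
by apply/esym/big_fset_incl => [|v vs /h//]; apply/fsubsetP.
Qed.

Lemma bc_le1 x v : bc x v <= 1.
Proof.
have [h0 h1 h2] := carrierP x.
have [vc|/h1 ->//] := boolP (v \in carrier x).
by rewrite -h2 (big_fsetD1 v)//= lerDl sumr_ge0.
Qed.

Lemma bc_inj x y : bc x =1 bc y -> x = y.
Proof.
move=> /funext xy; apply: (can_inj real_map_invK).
exact: val_inj.
Qed.

Lemma bc_pt v w : bc (pt v) w = (w == v)%:R.
Proof. by rewrite /bc /pt real_mapK. Qed.

Lemma pt_inj : injective pt.
Proof.
move=> v w vw; apply/eqP; have := bc_pt v v; rewrite vw bc_pt eqxx.
by case: eqP => // _ /eqP; rewrite eq_sym oner_eq0.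
Qed.

Lemma bc_eq1 x v : bc x v = 1 -> x = pt v.
Proof.
move=> xv; apply: bc_inj => w; rewrite bc_pt.
have [->|wv] := eqVneq w v; first by rewrite xv.
have vc : v \in carrier x by apply: bc_neq0_carrier; rewrite xv oner_neq0.
have := carrierP x; case=> h0 h1 h2.
have [wc|/h1 ->//] := boolP (w \in carrier x).
move: h2; rewrite (big_fsetD1 v)//= (big_fsetD1 w)/= ?in_fsetD1 ?wv//.
rewrite xv => /eqP; rewrite -subr_eq0 [1 + _]addrC addrK.
by rewrite paddr_eq0 ?sumr_ge0// => /andP[/eqP ->].
Qed.

Lemma bary_point s (a : vtx -> R) : face s -> barycentric s a ->
  exists x, bc x =1 a.
Proof.
move=> fs sa.
have h : a \in [set a | exists2 s, face s & barycentric s a].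
  by apply/mem_set; exists s.
by exists (real_map T (exist _ a h)) => v; rewrite /bc real_mapK.
Qed.

Lemma simplexP s x : simplex s x <-> barycentric s (bc x).
Proof.
split=> [[p ps <-]|sx]; first by rewrite /bc real_mapK.
by exists (real_map_inv x) => //; exact: real_map_invK.
Qed.

Lemma bc_pl s x : face s -> barycentric s (bc x) ->
  set_val x = \sum_(v <- s) bc x v *: set_val (pt v).
Proof.
move=> fs sx; have := @real_map_pl _ _ _ _ T s fs (real_map_inv x) sx.
by rewrite /= real_map_invK.
Qed.

Lemma linear_onP f : linear_on T f <->
  forall s x, face s -> barycentric s (bc x) ->
    f x = \sum_(v <- s) bc x v * f (pt v).
Proof.
split=> [h s x fs sx|h s fs p ps].
  by have := h s fs (real_map_inv x) sx; rewrite /= real_map_invK.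
by rewrite /= (h s)// /bc real_mapK.
Qed.

(** Coordinates vanish outside either face, so both sums agree with the one over the union. This
    removes the dependence on the chosen carrier. *)
Lemma sum_carrier (V : lmodType R) s x (F : vtx -> V) : barycentric s (bc x) ->
  \sum_(v <- s) bc x v *: F v = \sum_(v <- carrier x) bc x v *: F v.
Proof.
move=> [_ hs _]; have [_ hc _] := carrierP x.
transitivity (\sum_(v <- (s `|` carrier x)%fset) bc x v *: F v).
  by apply/big_fset_incl => [|v _ /hs ->]; [exact: fsubsetUl|rewrite scale0r].
apply/esym/big_fset_incl => [|v _ /hc ->]; first exact: fsubsetUr.
by rewrite scale0r.
Qed.

Lemma barycentric_pt s v : v \in s -> barycentric s (bc (pt v)).
Proof.
move=> vs; split=> [w|w|]; rewrite ?bc_pt ?ler0n//.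
  by case: eqP => // ->; rewrite vs.
rewrite (big_fsetD1 v)//= bc_pt eqxx big1_seq ?addr0//= => w.
by rewrite bc_pt in_fsetD1 => /andP[/negbTE ->].
Qed.

Lemma subcplx_A s x : subcplx s -> barycentric s (bc x) -> A (set_val x).
Proof.
move=> Ss sx; rewrite -(real_map_sub T); exists (real_map_inv x).
  by exists s.
by rewrite /= real_map_invK.
Qed.

Lemma A_subcplx x : A (set_val x) ->
  exists s, [/\ subcplx s, face s & barycentric s (bc x)].
Proof.
rewrite -{1}(real_map_sub T) => -[p [s Ss ps] /= pe].
have -> : x = real_map T p by apply: val_inj.
exists s; split => //; first exact: (subcplxP T).1.
by rewrite /bc real_mapK.
Qed.

(** A vertex in [A] belongs to some face of the subcomplex, which is closed under passing to
    subfaces. Hence free vertices can be described through [A] alone, a description common to all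
    levels. *)
Lemma A_pt v : A (set_val (pt v)) <-> subcplx [fset v]%fset.
Proof.
split=> [/A_subcplx[s [Ss fs sv]]|Sv].
  apply: ((subcplxP T).2 _ _ Ss).
    by apply/fset0Pn; exists v; rewrite inE.
  rewrite fsub1set; have [_ h _] := sv; apply: contraT => /h/eqP.
  by rewrite bc_pt eqxx oner_eq0.
by apply: (subcplx_A Sv); apply: barycentric_pt; rewrite inE.
Qed.

Lemma free_verticesP x :
  free_vertices T x <-> exists2 v, x = pt v & ~ A (set_val (pt v)).
Proof.
split=> [[v /= Sv <-]|[v -> Av]].
  by exists v => //; move/A_pt.
by exists v => //= /A_pt.
Qed.

Lemma pt_free v : A (set_val (pt v)) \/ free_vertices T (pt v).
Proof.
have [?|Av] := pselect (A (set_val (pt v))); first by left.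
by right; apply/free_verticesP; exists v.
Qed.

(** A point of [A] lies in a face of the subcomplex, and a vertex with nonzero coordinate must
    belong to that face. Vanishing on [A] can thus be checked at the vertices. *)
Lemma A_carrier x v : A (set_val x) -> bc x v != 0 -> A (set_val (pt v)).
Proof.
move=> /A_subcplx[s [Ss fs [_ h _]]] xv; apply/A_pt.
apply: ((subcplxP T).2 _ _ Ss); first by apply/fset0Pn; exists v; rewrite inE.
by rewrite fsub1set; apply: contraR xv => /h ->.
Qed.

Definition interp f x := \sum_(v <- carrier x) bc x v * f (pt v).

Lemma interpE f s x : barycentric s (bc x) ->
  interp f x = \sum_(v <- s) bc x v * f (pt v).
Proof. by move=> sx; rewrite (sum_carrier (f \o pt : vtx -> R^o) sx). Qed.

Lemma interp_pt f v : interp f (pt v) = f (pt v).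
Proof.
have h : v \in [fset v]%fset by rewrite inE.
rewrite (interpE _ (barycentric_pt h)) big_seq_fset1.
by rewrite bc_pt eqxx mul1r.
Qed.

Lemma interp_linear f : linear_on T (interp f).
Proof.
apply/linear_onP => s x fs sx; rewrite (interpE _ sx).
by apply: eq_bigr => v _; rewrite interp_pt.
Qed.

Lemma linear_interp f : linear_on T f -> f = interp f.
Proof.
move=> /linear_onP h; apply/funext => x.
by rewrite /interp -h//; [exact: carrier_face|exact: carrierP].
Qed.

Lemma linear_eq f g : linear_on T f -> linear_on T g ->
  (forall v, f (pt v) = g (pt v)) -> f = g.
Proof.
move=> /linear_interp ef /linear_interp eg h; rewrite ef eg; apply/funext => x.
by apply: eq_bigr => v _; rewrite h.
Qed.

Lemma linearB f g : linear_on T f -> linear_on T g ->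
  linear_on T (fun x => f x - g x).
Proof.
move=> /linear_onP hf /linear_onP hg; apply/linear_onP => s x fs sx.
rewrite (hf s)// (hg s)// -sumrB.
by apply: eq_bigr => v _; rewrite mulrBr.
Qed.

Lemma linearZ c f : linear_on T f -> linear_on T (fun x => c * f x).
Proof.
move=> /linear_onP hf; apply/linear_onP => s x fs sx.
rewrite (hf s)// mulr_sumr.
by apply: eq_bigr => v _; rewrite mulrCA.
Qed.

Definition hat v x := bc x v.

Lemma hat_linear v : linear_on T (hat v).
Proof.
apply/linear_onP => s x fs [h0 h1 h2].
have [vs|vs] := boolP (v \in s); last first.
  rewrite /hat h1// big1_seq// => w /= ws; rewrite bc_pt.
  by case: eqP => [vw|]; rewrite ?mulr0//; rewrite vw ws in vs.
rewrite (big_fsetD1 v)//= /hat bc_pt eqxx mulr1 big1_seq ?addr0// => w /=.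
by rewrite in_fsetD1 bc_pt eq_sym => /andP[/negbTE -> _]; rewrite mulr0.
Qed.

Lemma hat_vanishes v : ~ A (set_val (pt v)) -> vanishes_on_A (A:=A) (hat v).
Proof.
move=> Av x Ax; apply/eqP; apply: contra_notT Av => xv.
exact: A_carrier Ax xv.
Qed.

Lemma interp_vanishes f : vanishes_on_A (A:=A) f -> vanishes_on_A (A:=A) (interp f).
Proof.
move=> hf x Ax; apply: big1 => v _.
have [->|/(A_carrier Ax) Av] := eqVneq (bc x v) 0; first by rewrite mul0r.
by rewrite hf ?mulr0.
Qed.

End BarycentricCoordinates.

Arguments real_map_inv {R d X A} T.
Arguments bc {R d X A} T.
Arguments pt {R d X A} T.
Arguments carrier {R d X A} T.
Arguments interp {R d X A} T.
Arguments hat {R d X A} T.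

(** * Preliminaries on sequences, relative neighbourhoods and bounded closed sets *)

Lemma infinite_setPseq (T : Type) (A : set T) : infinite_set A ->
  exists u : nat -> T, injective u /\ forall n, A (u n).
Proof.
elim/Ppointed: T => T in A *.
  by rewrite emptyE => /infinite_setN0[].
move=> /infiniteP/pcard_leP[f]; exists f; split=> [m n fmn|n].
  by apply: (@inj _ _ _ f) => //; rewrite inE.
exact: funS.
Qed.

Lemma open_set_typeP (R : realType) d (X : set 'rV[R]_d) (U : set X) (x : X) :
  open U -> U x ->
  exists2 e : R, 0 < e & forall y : X, `|set_val x - set_val y| < e -> U y.
Proof.
move=> [W oW <-] /= Wx.
have : nbhs (set_val x) W by apply: open_nbhs_nbhs.
by move=> /nbhs_normP[e /= e0 he]; exists e => // y xy; exact: he.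
Qed.

Lemma closed_norm_le (R : realType) d (M : R) :
  closed [set z : 'rV[R]_d | `|z| <= M].
Proof.
rewrite (_ : mkset _ = closed_ball_ Num.norm 0 M).
  exact: closed_closed_ball_.
by apply/seteqP; split => z; rewrite /closed_ball_ /= sub0r normrN.
Qed.

Lemma compact_norm_le (R : realType) d (X : set 'rV[R]_d) (M : R) :
  closed X -> compact (X `&` [set z | `|z| <= M]).
Proof.
move=> clX; apply: bounded_closed_compact.
  exists M; split; first exact: num_real.
  by move=> r Mr z [_ /= zM]; exact: le_trans zM (ltW Mr).
by apply: closedI => //; exact: closed_norm_le.
Qed.

(** * Comparison of the weak and Euclidean topologies, and the resulting local finiteness *)

Section TriangulationTopology.
Context {R : realType} {d : nat} {X A : set 'rV[R]_d}.
Variable T : plTriangulation X A.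
Local Notation vtx := (vertex (cplx T)).
Implicit Types (x y : X) (s t : {fset vtx}) (v w : vtx) (f g : X -> R).

Lemma ptws_eval_continuous w : continuous (fun a : {ptws vtx -> R} => a w).
Proof. exact: (@proj_continuous vtx (fun=> R) w). Qed.

(** In the weak topology openness is tested on one closed simplex at a time. There only the finitely
    many conditions at its own vertices count, the others reading [0 < e w]. The bounds [e] may
    therefore shrink arbitrarily from vertex to vertex. *)
Lemma open_bc_lt (D : set vtx) (e : vtx -> R) : (forall w, 0 < e w) ->
  open [set x | forall w, D w -> bc T x w < e w].
Proof.
move=> e0; have [_ _ _ cinv] := real_map_invP T.
pose U := [set p : realization R (cplx T) |
  forall w, D w -> coords p w < e w].
suff oU : open U by exact: (open_comp (fun x _ => cinv x) oU).
suff : weak_open U by [].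
move=> s fs.
exists (\big[setI/setT]_(w <- s) [set a : {ptws vtx -> R} | D w -> a w < e w]).
  apply: big_ind => [||w _]; [exact: openT|exact: openI|].
  have [Dw|nDw] := pselect (D w); last first.
    by rewrite (_ : mkset _ = setT); [exact: openT|apply/seteqP; split => // a _ /nDw].
  have := open_comp (fun a _ => @ptws_eval_continuous w a) (@open_lt R (e w)).
  rewrite /= (_ : _ @^-1` _ = [set a | D w -> a w < e w])//.
  by apply/seteqP; split => [a /= ?|a /= /(_ Dw)].
move=> p [h0 h1 _]; rewrite -bigcap_seq; split => [Up w /= _|h w Dw].
  exact: Up.
have [ws|/h1 ->//] := boolP (w \in s).
exact: h ws Dw.
Qed.

Lemma bc_continuous v : continuous (fun x => bc T x v).
Proof.
have [_ _ _ cinv] := real_map_invP T.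
apply/continuousP => O oO.
pose U := [set p : realization R (cplx T) | O (coords p v)].
suff oU : open U by exact: (open_comp (fun x _ => cinv x) oU).
suff : weak_open U by [].
move=> s fs; exists [set a : {ptws vtx -> R} | O (a v)] => //.
exact: (open_comp (fun a _ => @ptws_eval_continuous v a) oO).
Qed.

Lemma barycentric_bcP s x :
  barycentric s (bc T x) <-> forall v, v \notin s -> bc T x v = 0.
Proof.
split=> [[]//|h]; split=> //; first by move=> v; exact: bc_ge0.
rewrite -(sum_bc (x := x) (s := (s `|` carrier T x)%fset)); last first.
  by move=> v; rewrite inE orbC => ->.
by apply/big_fset_incl => [|v _ /h//]; exact: fsubsetUl.
Qed.

Lemma simplex_closed s : closed [set x | barycentric s (bc T x)].
Proof.
rewrite (_ : mkset _ = \bigcap_(v in [set v | v \notin s])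
    ((fun x => bc T x v) @^-1` [set 0])).
  apply: closed_bigI => v _; apply: closed_comp => //.
  by move=> x _; exact: bc_continuous.
by apply/seteqP; split=> x /= => [/barycentric_bcP//|h]; apply/barycentric_bcP.
Qed.

(* If v had infinitely many neighbours w_n, points on the edges v w_n converging
   to v in X would be missed by a weak neighbourhood of v whose size along each
   of these edges is tailored to them. *)
Lemma finite_neighbors v : finite_set [set w | face [fset v; w]%fset].
Proof.
apply: contrapT => /infinite_setPseq[u [uinj uN]].
(* Both [D n] and [D n] times the length of the edge to [u n] are at most 1/(n+1), so the point at
   parameter [D n] on that edge tends to [v]. *)
pose D n := (n.+1%:R * (1 + `|set_val (pt T v) - set_val (pt T (u n))|))^-1.
have D0 n : 0 < D n by rewrite invr_gt0 mulr_gt0 ?ltr0n// ltr_pwDl.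
have D1 n : D n <= 1.
  rewrite invf_le1 ?mulr_gt0 ?ltr0n ?ltr_pwDl//.
  by rewrite -[X in X <= _]mulr1 ler_pM ?ler1n ?lerDl.
have [k kP] : exists k : vtx -> nat, forall n, k (u n) = n.
  exists (fun w => xget 0%N [set n | u n = w]) => n.
  by case: xgetP => [m _ /uinj//|/(_ n)/(_ erefl)].
pose e w := D (k w).
have := @open_bc_lt [set w | w != v] e (fun w => D0 _).
move=> /open_set_typeP-/(_ (pt T v))[|r r0 hr].
  by move=> w /= /negbTE wv; rewrite bc_pt wv D0.
have [N Nr] : exists N, forall n, (N <= n)%N -> n.+1%:R^-1 < r.
  have [N _ h] := near_infty_natSinv_lt (PosNum r0).
  by exists N => n Nn; exact: h.
(* The set [[fset v; v]] is a face too, so [v] itself may occur in the sequence, but only once by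
   injectivity. *)
have [n Nn unv] : exists2 n, (N <= n)%N & u n != v.
  have [uN1|?] := eqVneq (u N) v; last by exists N.
  exists N.+1 => //; rewrite -uN1; apply/negP => /eqP/uinj/eqP.
  by rewrite gtn_eqF.
pose a w := (1 - D n) * (w == v)%:R + D n * (w == u n)%:R.
have aP : barycentric [fset v; u n]%fset a.
  split=> [w|w|].
  - by rewrite addr_ge0// mulr_ge0 ?subr_ge0 ?ler0n// ltW.
  - by rewrite /a !inE negb_or => /andP[/negbTE -> /negbTE ->]; rewrite !mulr0 addr0.
  - rewrite big_fsetU1 ?inE 1?eq_sym//= big_seq_fset1 /a !eqxx (negbTE unv).
    by rewrite eq_sym (negbTE unv) !mulr1 !mulr0 addr0 add0r subrK.
have [x xa] := bary_point (uN n) aP.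
have : `|set_val (pt T v) - set_val x| < r.
  have sx : barycentric [fset v; u n]%fset (bc T x) by rewrite (funext xa).
  rewrite (bc_pl (uN n) sx) big_fsetU1 ?inE 1?eq_sym//= big_seq_fset1.
  rewrite !xa /a !eqxx (negbTE unv) [v == _]eq_sym (negbTE unv) !mulr1 !mulr0 addr0 add0r.
  rewrite scalerBl scale1r opprD opprB addrA addrCA subrr addr0 -scalerBr.
  rewrite normrZ gtr0_norm// (le_lt_trans _ (Nr n Nn))// /D invfM -mulrA.
  rewrite ler_piMr ?invr_ge0// mulrC ler_pdivrMr ?mul1r ?ltr_pwDl//.
  by rewrite lerDr.
move=> /hr/(_ (u n) unv); rewrite xa /a eqxx (negbTE unv) /e kP.
by rewrite mulr0 mulr1 add0r ltxx.
Qed.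

(** Infinitely many vertices in a bounded set would accumulate at some [x] in [X]. The points whose
    coordinates at all vertices other than [x] are below 1 form a neighbourhood of [x], and it
    contains no vertex except possibly [x], since a vertex has coordinate 1 at itself. *)
Lemma finite_bounded_vertices (M : R) : closed X ->
  finite_set [set v | `|set_val (pt T v)| <= M].
Proof.
move=> clX; apply: contrapT => /infinite_setPseq[u [uinj uM]].
have := @compact_norm_le _ _ _ M clX ((set_val \o pt T \o u) @ \oo) _ _.
case=> [|z [[Xz zM] clz]].
  by exists 0%N => // n _; split; [exact: set_valP|exact: uM].
pose x : X := SigSub (mem_set Xz).
have := @open_bc_lt [set w | pt T w <> x] (fun=> 1) (fun=> ltr01).
move=> /open_set_typeP-/(_ x)[|r r0 hr].
  move=> w /= wx; rewrite lt_neqAle bc_le1 andbT.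
  by apply/eqP => xw; apply: wx; apply/esym/bc_eq1.
have hit N : exists2 n, (N <= n)%N & pt T (u n) = x.
  have := clz [set (set_val \o pt T \o u) n | n in [set n | (N <= n)%N]]
              (ball z r).
  case=> [|| _ [[n /= Nn <-] /= zr]].
  - by exists N => // n Nn; exists n.
  - exact: nbhsx_ballx.
  exists n => //; apply: contrapT => nx.
  have := hr (pt T (u n)); rewrite -ball_normE /= in zr.
  by move=> /(_ zr)/(_ (u n) nx); rewrite bc_pt eqxx ltxx.
have [n _ nx] := hit 0%N; have [m nm mx] := hit n.+1.
have := etrans nx (esym mx); move=> /pt_inj/uinj nme.
by rewrite nme ltnn in nm.
Qed.

End TriangulationTopology.

(* Follow one of the sets containing a up to its last point in [a, b]: beyond
   it one set less is needed, so induction on their number applies. *)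
Lemma lipschitz_finite_closed_cover (R : realType) (I : eqType) (F : I -> set R)
    (phi : R -> R) (C : R) (r : seq I) (a b : R) :
  0 <= C -> continuous phi -> (forall i, closed (F i)) ->
  (forall i x y, F i x -> F i y -> `|phi x - phi y| <= C * `|x - y|) ->
  a <= b -> (forall t, a <= t <= b -> exists2 i, i \in r & F i t) ->
  `|phi a - phi b| <= C * (b - a).
Proof.
move=> C0 cphi clF lipF; have [n] := ubnP (size r).
elim: n r a b => // n IH r a b rn ab cov.
have [|i ir Fia] := cov a; first by rewrite lexx.
pose E := F i `&` [set t | a <= t <= b].
have Ea : E a by split => //=; rewrite lexx.
have ubE : has_ubound E by exists b => t [_ /= /andP[]].
have [Fim /andP[am mb]] : E (sup E).
  have clE : closed E.
    apply: closedI => //; rewrite (_ : mkset _ = `[a, b]%classic).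
      exact: interval_closed.
    by apply/seteqP; split => t /=; rewrite in_itv.
  have := @closure_sup R E; rewrite -(closure_id E).1//; apply => //.
  by exists a.
set m := sup E in Fim am mb.
have hm : `|phi a - phi m| <= C * (m - a).
  by rewrite (le_trans (lipF _ _ _ Fia Fim))// distrC ger0_norm// subr_ge0.
suff hb : `|phi m - phi b| <= C * (b - m).
  have -> : phi a - phi b = (phi a - phi m) + (phi m - phi b) by rewrite addrA subrK.
  rewrite (le_trans (ler_normD _ _))// (le_trans (lerD hm hb))//.
  by rewrite -mulrDr addrC addrA subrK.
have IHm t : m < t -> t <= b -> `|phi t - phi b| <= C * (b - t).
  move=> mt tb; apply: (IH [seq j <- r | j != i]) => //.
    rewrite size_filter (leq_trans _ (_ : size r <= n)%N)//.
    by rewrite -(count_predC (predC1 i) r) -addn1 leq_add2l -has_count; apply/hasP;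
       exists i => //=; rewrite eqxx.
  move=> u /andP[tu ub]; have mu := lt_le_trans mt tu.
  have [|j jr Fju] := cov u; first by rewrite (le_trans am (ltW mu)).
  exists j => //; rewrite mem_filter jr andbT.
  apply: contraTneq mu => ji; rewrite -leNgt; apply: ub_le_sup => //.
  by split; [rewrite -ji|rewrite /= ub (le_trans am)// (le_trans (ltW mt))].
(* The bound holds at every point beyond [m]. If it failed at [m], continuity would make it fail
   slightly to the right of [m] as well. *)
rewrite leNgt; apply/negP => lt.
have mltb : m < b.
  by rewrite lt_neqAle mb andbT; apply: contraTneq lt => ->; rewrite !subrr normr0 mulr0 ltxx.
pose psi t := `|phi t - phi b| - C * (b - t).
have cpsi : {for m, continuous psi}.
  apply: cvgB; last by apply: cvgMr; apply: cvgB; [exact: cvg_cst|exact: cvg_id].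
  by apply: cvg_norm; apply: cvgB; [exact: cphi|exact: cvg_cst].
have : \forall t \near m, 0 < psi t.
  by apply: (cvgr_gt _ cpsi); rewrite subr_gt0.
move=> /nbhs_ballP[e /= e0 he].
have mt : m < Num.min b (m + e / 2) by rewrite lt_min mltb ltrDl divr_gt0.
have : ~ 0 < psi (Num.min b (m + e / 2)).
  by rewrite /psi subr_gt0 ltNge IHm// ge_min lexx.
apply; apply: he; rewrite /ball /=.
rewrite distrC gtr0_norm ?subr_gt0// ltrBlDl gt_min ltrD2l.
by rewrite ltr_pdivrMr// ltr_pMr// ltr1n orbT.
Qed.

(** * Affine independence of the vertices of a face, and affinity of the coordinates *)

Section HatFunctions.
Context {R : realType} {d : nat} {X A : set 'rV[R]_d}.
Variable T : plTriangulation X A.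
Local Notation vtx := (vertex (cplx T)).
Implicit Types (x y : X) (s t : {fset vtx}) (v w : vtx) (f g : X -> R).

(* Moving the barycentre of s a little in the direction u would give two
   points of s with the same image. *)
Lemma vertices_affinely_free s (u : vtx -> R) : face s ->
  \sum_(w <- s) u w *: set_val (pt T w) = 0 -> \sum_(w <- s) u w = 0 ->
  forall w, w \in s -> u w = 0.
Proof.
move=> fs h0 h1.
have s0 : (0 < #|` s|)%N by rewrite cardfs_gt0 face_neq0.
pose n : R := (#|` s|)%:R.
have n0 : 0 < n by rewrite ltr0n.
(* As [S] exceeds every [|u w|], the perturbation [(n * S)^-1 * u w] is smaller than [n^-1], and the
   perturbed coordinates stay nonnegative. *)
pose S := 1 + \sum_(w <- s) `|u w|.
have S0 : 0 < S by rewrite ltr_pwDl// sumr_ge0.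
pose b w : R := if w \in s then n^-1 else 0.
pose a w : R := if w \in s then n^-1 + (n * S)^-1 * u w else 0.
have eqs (V : zmodType) (F G : vtx -> V) : (forall w, w \in s -> F w = G w) ->
    \sum_(w <- s) F w = \sum_(w <- s) G w.
  by move=> FG; rewrite big_seq [RHS]big_seq; apply: eq_bigr.
have sb : barycentric s b.
  split => [w|w /negbTE ws|]; rewrite /b; first by case: ifP => // _; rewrite invr_ge0 ltW.
    by rewrite ws.
  rewrite (eqs _ _ (fun=> n^-1)) => [|w ->//].
  by rewrite big_const_seq count_predT iter_addr addr0 -mulr_natr mulVf// gt_eqF.
have sa : barycentric s a.
  split => [w|w /negbTE ws|]; rewrite /a.
  - case: ifP => // ws; rewrite invfM -mulrA -[X in X + _]mulr1 -mulrDr.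
    apply: mulr_ge0; first by rewrite invr_ge0 ltW.
    rewrite -lerBlDl sub0r mulrC ler_pdivlMr//.
    rewrite mulN1r lerNl (le_trans (ler_norm _))// normrN /S.
    by rewrite (big_fsetD1 w)//= addrCA lerDl addr_ge0// sumr_ge0.
  - by rewrite ws.
  - rewrite (eqs _ _ (fun w => n^-1 + (n * S)^-1 * u w)) => [|w ->//].
    rewrite big_split/= -mulr_sumr h1 mulr0 addr0.
    by rewrite big_const_seq count_predT iter_addr addr0 -mulr_natr mulVf// gt_eqF.
have [x xa] := bary_point fs sa; have [y yb] := bary_point fs sb.
have xy : x = y.
  apply: val_inj; change (set_val x = set_val y); rewrite (bc_pl fs) ?(funext xa)//.
  rewrite (bc_pl fs) ?(funext yb)//.
  rewrite (eqs _ _ (fun w => n^-1 *: set_val (pt T w)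
     + (n * S)^-1 *: (u w *: set_val (pt T w)))); last first.
    by move=> w ws; rewrite /a ws scalerDl scalerA.
  rewrite big_split/= -[X in _ + X]scaler_sumr h0 scaler0 addr0.
  by apply: eqs => w ws; rewrite /b ws.
move=> w ws; have := xa w; rewrite xy yb /a /b ws => /eqP.
rewrite -subr_eq0 opprD addrA subrr sub0r oppr_eq0 mulf_eq0 invr_eq0.
by rewrite mulf_eq0 (gt_eqF n0) (gt_eqF S0) => /eqP.
Qed.

(** By affine independence the rows (vertex, 1) of [M] are linearly independent, so [M] has a right
    inverse [N]. The row of coordinates of [x] times [M] is ([x], 1); multiplying by [N] recovers
    the coordinates as affine functions of [x]. *)
Lemma bc_affine s v : face s -> exists (c : 'I_d -> R) (b : R), forall x,
  barycentric s (bc T x) -> bc T x v = \sum_i c i * set_val x 0 i + b.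
Proof.
move=> fs; have [vs|vs] := boolP (v \in s); last first.
  exists (fun=> 0), 0 => x [_ -> // _].
  by rewrite big1 ?addr0// => i _; rewrite mul0r.
pose n := size s; pose p (i : 'I_n) := nth v s i.
have sumE (V : zmodType) (F : vtx -> V) : \sum_(w <- s) F w = \sum_i F (p i).
  by rewrite (big_nth v) big_mkord.
pose M : 'M[R]_(n, d + 1) := \matrix_i row_mx (set_val (pt T (p i))) 1.
have rowM (a : 'rV_n) : a *m M =
    row_mx (\sum_i a 0 i *: set_val (pt T (p i))) (\sum_i a 0 i)%:M.
  rewrite mulmx_sum_row (eq_bigr (fun i => row_mx (a 0 i *: set_val (pt T (p i)))
      (a 0 i)%:M)); last first.
    by move=> i _; rewrite rowK scale_row_mx scalemx1.
  elim/big_rec3: _ => [|i x y z _ ->]; first by rewrite raddf0 row_mx0.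
  by rewrite add_row_mx raddfD.
have freeM : row_free M.
  apply: inj_row_free => a; rewrite rowM -row_mx0 => /eq_row_mx[h0 h1].
  pose u w := if insub (index w s) is Some i then a 0 i else 0.
  have up i : u (p i) = a 0 i.
    by rewrite /u /p index_uniq ?fset_uniq// valK.
  apply/rowP => i; rewrite mxE -up; apply: (vertices_affinely_free fs).
  - by rewrite sumE; under eq_bigr do rewrite up.
  - rewrite sumE; under eq_bigr do rewrite up.
    by have /matrixP/(_ 0 0) := h1; rewrite !mxE eqxx mulr1n.
  - by rewrite mem_nth.
have vi : (index v s < n)%N by rewrite index_mem.
have [N MN] : exists N, M *m N = 1%:M by exists (pinvmx M); exact: mulmxVp.
exists (fun j => N (lshift 1 j) (Ordinal vi)), (N (rshift d 0) (Ordinal vi)) => x sx.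
pose a : 'rV_n := \row_i bc T x (p i).
have aM : a *m M = row_mx (set_val x) 1.
  rewrite rowM; congr row_mx.
    by rewrite (bc_pl fs sx) sumE; apply: eq_bigr => i _; rewrite mxE.
  rewrite -[RHS]/(1%:M); congr (_%:M); have [_ _ <-] := sx.
  by rewrite sumE; apply: eq_bigr => i _; rewrite mxE.
have : a *m M *m N = a by rewrite -mulmxA MN mulmx1.
rewrite aM => /rowP/(_ (Ordinal vi)).
rewrite !mxE /p nth_index// => <-.
rewrite big_split_ord/= big_ord1 row_mxEr mxE eqxx mul1r; congr (_ + _).
by apply: eq_bigr => i _; rewrite row_mxEl mulrC.
Qed.

End HatFunctions.

(** * Euclidean distance, clamped parameters, convexity and closedness of polyhedra *)

Section EuclideanDistance.
Context {R : realType} {d : nat}.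
Implicit Types (x y z : 'rV[R]_d).

Lemma eucl_dist_ge0 x y : 0 <= eucl_dist x y.
Proof. exact: sqrtr_ge0. Qed.

Lemma coord_le_eucl_dist x y i : `|x 0 i - y 0 i| <= eucl_dist x y.
Proof.
rewrite -sqrtr_sqr; apply: ler_wsqrtr.
by rewrite (bigD1 i)//= lerDl sumr_ge0// => j _; exact: sqr_ge0.
Qed.

Lemma norm_le_eucl_dist x y : `|x - y| <= eucl_dist x y.
Proof.
rewrite [leLHS]/Num.norm/= mx_normrE; apply: bigmax_le.
  exact: eucl_dist_ge0.
by move=> [i j] _ /=; rewrite (ord1 i) !mxE; exact: coord_le_eucl_dist.
Qed.

Lemma eucl_dist_gt0 x y : x != y -> 0 < eucl_dist x y.
Proof.
move=> xy; apply: lt_le_trans (norm_le_eucl_dist x y).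
by rewrite normr_gt0 subr_eq0.
Qed.

Lemma eucl_dist_scale (c : R) x y x' y' :
  x' - y' = c *: (x - y) -> eucl_dist x' y' = `|c| * eucl_dist x y.
Proof.
move=> h; rewrite /eucl_dist -sqrtr_sqr -sqrtrM ?sqr_ge0// mulr_sumr.
congr Num.sqrt; apply: eq_bigr => i _; rewrite -exprMn.
by have /rowP/(_ i) := h; rewrite !mxE => ->.
Qed.

End EuclideanDistance.

Section Clamp.
Context {R : realType}.

Definition clamp (t : R) : R := Num.max 0 (Num.min 1 t).

Lemma clamp_itv t : 0 <= clamp t <= 1.
Proof. by rewrite /clamp le_max lexx/= ge_max ler01 ge_min lexx. Qed.

Lemma clamp_id t : 0 <= t <= 1 -> clamp t = t.
Proof. by move=> /andP[t0 t1]; rewrite /clamp min_r// max_r. Qed.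

Lemma clamp_lip t u : `|clamp t - clamp u| <= `|t - u|.
Proof.
wlog tu : t u / t <= u.
  by move=> h; have [/h//|/ltW/h] := leP t u; rewrite distrC [leRHS]distrC.
have h : clamp t <= clamp u by rewrite /clamp le_max2 ?lexx// le_min2.
rewrite distrC [leRHS]distrC !ger0_norm ?subr_ge0//.
rewrite /clamp {h} !maxEle !minEle.
have [t1|t1] := leP 1 t; have [u1|u1] := leP 1 u; rewrite ?ler01;
  have [t0|t0] := leP 0 t; have [u0|u0] := leP 0 u; lra.
Qed.

Lemma clamp_continuous : continuous clamp.
Proof.
apply: (@max_fun_continuous _ R R (fun=> 0) (fun t => Num.min 1 t)).
  by move=> t; exact: cvg_cst.
apply: (@min_fun_continuous _ R R (fun=> 1) id) => t; first exact: cvg_cst.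
exact: cvg_id.
Qed.

End Clamp.

Definition convex_points (R : realType) d (X : set 'rV[R]_d) : Prop :=
  forall x y t, X x -> X y -> 0 <= t <= 1 -> X ((1 - t) *: x + t *: y).

Section Polyhedron.
Context {R : realType} {d : nat}.
Implicit Types (X : set 'rV[R]_d).

Lemma polyhedron_convex X : polyhedron X -> convex_points X.
Proof.
move=> [m [a [b [_ ->]]]] x y t hx hy /andP[t0 t1] i _.
have := hx i I; have := hy i I; rewrite /halfspace /= => yb xb.
have -> : \sum_j a i 0 j * ((1 - t) *: x + t *: y) 0 j =
  (1 - t) * (\sum_j a i 0 j * x 0 j) + t * (\sum_j a i 0 j * y 0 j).
  rewrite !mulr_sumr -big_split; apply: eq_bigr => j _ /=.
  by rewrite !mxE mulrDr !(mulrCA (a i 0 j)).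
rewrite [leRHS](_ : _ = (1 - t) * b i + t * b i); last by rewrite -mulrDl subrK mul1r.
by rewrite lerD// ler_wpM2l// subr_ge0.
Qed.

Lemma halfspace_closed (a : 'rV[R]_d) (b : R) : closed (halfspace a b).
Proof.
apply: (@closed_comp _ _ (fun x : 'rV[R]_d => \sum_i a 0 i * x 0 i) [set y | y <= b]);
  last exact: closed_le.
move=> x _; have FF : Filter (nbhs x) := nbhs_filter x; apply: (@cvg_big _ _ +%R) => [|i _].
  by move=> [u v]; exact: add_continuous.
apply: (@continuous_comp _ _ _ (fun x : 'rV[R]_d => x 0 i) ( *%R (a 0 i))).
  exact: coord_continuous.
exact: mulrl_continuous.
Qed.

Lemma polyhedron_closed X : polyhedron X -> closed X.
Proof.
move=> [m [a [b [_ ->]]]]; apply: closed_bigI => i _; exact: halfspace_closed.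
Qed.

End Polyhedron.

(** * Lipschitz continuity and bounded support of the hats *)

Section HatLipschitz.
Context {R : realType} {d : nat} {X A : set 'rV[R]_d}.
Variable T : plTriangulation X A.
Hypothesis convX : convex_points X.
Local Notation vtx := (vertex (cplx T)).
Implicit Types (x y : X) (s : {fset vtx}) (v w : vtx) (f : X -> R).

(* Clamping the parameter makes the segment a total continuous map into X. *)
Definition segment_point x y (t : R) : X :=
  SigSub (mem_set (convX (set_valP x) (set_valP y) (clamp_itv t))).

Lemma segment_pointE x y t :
  set_val (segment_point x y t) =
  (1 - clamp t) *: set_val x + clamp t *: set_val y.
Proof. by []. Qed.

Lemma segment_point_continuous x y : continuous (segment_point x y).
Proof.
apply: continuous_comp_initial => t; apply: cvgD; apply: cvgZr_tmp.
  by apply: cvgB; [exact: cvg_cst|exact: clamp_continuous].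
exact: clamp_continuous.
Qed.

Lemma segment_point0 x y : segment_point x y 0 = x.
Proof.
apply: val_inj; change (set_val (segment_point x y 0) = set_val x).
by rewrite segment_pointE clamp_id ?lexx ?ler01// subr0 scale1r scale0r addr0.
Qed.

Lemma segment_point1 x y : segment_point x y 1 = y.
Proof.
apply: val_inj; change (set_val (segment_point x y 1) = set_val y).
by rewrite segment_pointE clamp_id ?lexx ?ler01// subrr scale1r scale0r add0r.
Qed.

Lemma segment_point_dist x y t u :
  eucl_dist (set_val (segment_point x y t)) (set_val (segment_point x y u)) <=
  `|t - u| * eucl_dist (set_val x) (set_val y).
Proof.
rewrite (@eucl_dist_scale _ _ (clamp u - clamp t) (set_val x) (set_val y)).
  by rewrite ler_wpM2r ?eucl_dist_ge0// [leRHS]distrC clamp_lip.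
by rewrite !segment_pointE; apply/rowP => i; rewrite !mxE; lra.
Qed.

(** The assumption [face s] is placed after the constant so that one constant can be chosen for
    every finite set [s], face or not. *)
Lemma bc_lipschitz_on s v : exists2 k, 0 <= k & face s -> forall x y,
  barycentric s (bc T x) -> barycentric s (bc T y) ->
  `|bc T x v - bc T y v| <= k * eucl_dist (set_val x) (set_val y).
Proof.
have [fs|nfs] := pselect (face s); last by exists 0.
have [c [b cb]] := bc_affine v fs.
exists (\sum_i `|c i|) => [|_ x y sx sy]; first exact: sumr_ge0.
rewrite (cb x sx) (cb y sy) opprD addrACA subrr addr0 -sumrB mulr_suml.
rewrite (le_trans (ler_norm_sum _ _ _))//; apply: ler_sum => i _.
by rewrite -mulrBr normrM ler_wpM2l// coord_le_eucl_dist.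
Qed.

(** All sets of neighbours of [v]: a finite list that contains the faces through [v], but possibly
    also sets that are not faces. *)
Definition star_faces v : seq {fset vtx} :=
  fpowerset (fset_set [set w | face [fset v; w]%fset]).

Lemma mem_star_faces s v : face s -> v \in s -> s \in star_faces v.
Proof.
move=> fs vs; rewrite fpowersetE; apply/fsubsetP => w ws.
rewrite in_fset_set; last exact: finite_neighbors.
rewrite inE /=; apply: (face_sub fs).
  by apply/fset0Pn; exists v; rewrite !inE eqxx.
by apply/fsubsetP => z; rewrite !inE => /orP[] /eqP ->.
Qed.

(** The segment from [x] to [y] stays in [X] by convexity. It is covered by the finitely many faces
    through [v], on each of which the hat is Lipschitz, together with the zero set of the hat. *)
Lemma hat_lipschitz v : exists2 k, 0 <= k & lipschitz_with k (hat T v).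
Proof.
have /all_sig2[k k0 kP] s := cid2 (bc_lipschitz_on s v).
pose C := \sum_(s <- star_faces v) k s.
have C0 : 0 <= C by exact: sumr_ge0.
exists C => // x y.
pose z := segment_point x y.
(* The covering lemma asks for closedness and the Lipschitz bound at every index, so the set is
   empty unless [s] is a face listed in the star. The index [None] stands for the zero set of the
   hat. *)
pose F (o : option {fset vtx}) : set R := if o is Some s then
    [set t | [/\ s \in star_faces v, face s & barycentric s (bc T (z t))]]
  else [set t | bc T (z t) v = 0].
pose r := None :: [seq Some s | s <- star_faces v].
pose D := eucl_dist (set_val x) (set_val y).
have D0 : 0 <= D := eucl_dist_ge0 _ _.
have cz : continuous z by exact: segment_point_continuous.
pose phi t := bc T (z t) v.
have cphi : continuous phi.
  by move=> t; exact: (continuous_comp (@cz t) (@bc_continuous _ _ _ _ T v (z t))).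
have -> : hat T v x = phi 0 by rewrite /phi /z segment_point0.
have -> : hat T v y = phi 1 by rewrite /phi /z segment_point1.
have := @lipschitz_finite_closed_cover R _ F phi (C * D) r 0 1.
rewrite subr0 mulr1; apply => //; first exact: mulr_ge0.
- move=> [s|] /=; last by apply: (@closed_comp _ _ phi [set 0]) => // t _; exact: cphi.
  have [ss|ns] := boolP (s \in star_faces v); last first.
    by rewrite (_ : mkset _ = set0); [exact: closed0|apply/seteqP; split => // t []].
  have [fs|nfs] := pselect (face s); last first.
    by rewrite (_ : mkset _ = set0); [exact: closed0|apply/seteqP; split => // t []].
  rewrite (_ : mkset _ = z @^-1` [set x | barycentric s (bc T x)]).
    by apply: closed_comp; [move=> t _; exact: cz|exact: simplex_closed].
  by apply/seteqP; split => t => [[]|].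
- move=> [s|] t u /=; last first.
    by move=> t0 u0; rewrite /phi t0 u0 subrr normr0 !mulr_ge0.
  move=> [ss fs st] [_ _ su]; rewrite (le_trans (kP s fs _ _ st su))//.
  apply: (@le_trans _ _ (k s * (`|t - u| * D))).
    by rewrite ler_wpM2l// segment_point_dist.
  rewrite mulrCA mulrC ler_wpM2r//  ler_wpM2r//.
  rewrite /C (bigD1_seq s)//= ?lerDl ?sumr_ge0//; exact: fset_uniq.
- move=> t _; have [vc|vc] := boolP (v \in carrier T (z t)).
    exists (Some (carrier T (z t))).
      rewrite inE/=; apply: map_f; apply: mem_star_faces => //.
      exact: carrier_face.
    split; [|exact: carrier_face|exact: carrierP].
    by apply: mem_star_faces => //; exact: carrier_face.
  exists None; rewrite ?inE//=.
  by have [_ h _] := carrierP T (z t); exact: h.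
Qed.

(** A filter on the subtype is pushed forward to the ambient space, where a closed bounded set
    provides a cluster point; as [X] is closed, this point lies in [X]. *)
Lemma bounded_compactly_supported f (M : R) : closed X ->
  (forall x, f x != 0 -> `|set_val x| <= M) -> compactly_supported f.
Proof.
move=> clX fM.
pose K : set X := [set x | `|set_val x| <= M].
have clK : closed K.
  exact: (closed_comp (fun x _ => @initial_continuous _ _ (set_val : X -> _) x) (@closed_norm_le _ _ M)).
apply: (@compactly_supported_sub _ _ _ f K) => //.
move=> F PF FK; have := @compact_norm_le _ _ _ M clX ((set_val : X -> 'rV[R]_d) @ F) _ _.
case=> [|z [[Xz zM] clz]].
  change (F ((set_val : X -> 'rV[R]_d) @^-1` (X `&` [set z | `|z| <= M]))).
  by apply: filterS FK => x Kx; split; [exact: set_valP|].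
exists (SigSub (mem_set Xz)); split=> // B U FB [V [[W oW <-] Wz] VU].
have [||_ [[x Bx <-] Wx]] := clz ((set_val : X -> 'rV[R]_d) @` B) W.
- change (F ((set_val : X -> 'rV[R]_d) @^-1` (set_val @` B))).
  by apply: filterS FB => x Bx; exists x.
- exact: open_nbhs_nbhs.
- by exists x; split => //; apply: VU.
Qed.

(** Where the hat is nonzero, the carrier contains [v], so the point is a convex combination of the
    finitely many neighbours of [v]. *)
Lemma hat_support_bounded v : exists M, forall x, hat T v x != 0 -> `|set_val x| <= M.
Proof.
pose N : {fset vtx} := fset_set [set w | face [fset v; w]%fset].
exists (\sum_(w <- N) `|set_val (pt T w)|) => x /bc_neq0_carrier vx.
have [h0 _ h1] := carrierP T x.
rewrite (bc_pl (carrier_face T x) (carrierP T x)).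
rewrite (le_trans (ler_norm_sum _ _ _))//.
set M := (X in _ <= X); rewrite -[M]mul1r -h1 mulr_suml !big_seq; apply: ler_sum => w wc.
rewrite normrZ ger0_norm// ler_wpM2l//.
have wN : w \in N.
  by have := mem_star_faces (carrier_face T x) vx; rewrite fpowersetE => /fsubsetP; exact.
by rewrite /M (big_fsetD1 w)//= lerDl sumr_ge0.
Qed.

Lemma interp_support_bounded f : finite_set [set v | f (pt T v) != 0] ->
  exists M, forall x, interp T f x != 0 -> `|set_val x| <= M.
Proof.
move=> finf; have /all_sig[M MP] v := cid (hat_support_bounded v).
pose N := fset_set [set v | f (pt T v) != 0].
exists (\sum_(v <- N) `|M v|) => x fx.
have [v [vN xv]] : exists v, v \in N /\ hat T v x != 0.
  apply: contrapT => h; move/eqP: fx; apply; apply: big1 => v _.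
  have [->|xv] := eqVneq (bc T x v) 0; first by rewrite mul0r.
  have [->|fv] := eqVneq (f (pt T v)) 0; first by rewrite mulr0.
  by exfalso; apply: h; exists v; rewrite in_fset_set// inE.
rewrite (le_trans (MP v x xv))// (le_trans (ler_norm _))//.
by rewrite (big_fsetD1 v)//= lerDl sumr_ge0.
Qed.

End HatLipschitz.

(** * Best Lipschitz constants and the characterisation of the kernels *)

Section BestLipschitzConstant.
Context {R : realType} {d : nat} {X : set 'rV[R]_d}.
Implicit Types (f : X -> R).

Lemma lipschitz_withZ f k c : lipschitz_with k f ->
  lipschitz_with (`|c| * k) (fun x => c * f x).
Proof.
by move=> h x y; rewrite -mulrBr normrM -mulrA ler_wpM2l.
Qed.

Lemma LipZ f c : 0 < c -> Lip (fun x => c * f x) = (c%:E * Lip f)%E.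
Proof.
move=> c0; rewrite /Lip -ereal_inf_pZl// image_comp; congr ereal_inf.
apply/seteqP; split => _ [k [k0 kf] <-].
  exists (c^-1 * k); last by rewrite /= -EFinM mulVKf// gt_eqF.
  split; first by rewrite mulr_ge0// invr_ge0 ltW.
  have := lipschitz_withZ c^-1 kf; rewrite gtr0_norm ?invr_gt0//.
  by congr lipschitz_with; apply/funext => x; rewrite mulKf// gt_eqF.
exists (c * k); last by rewrite /= EFinM.
split; first by rewrite mulr_ge0// ltW.
by have := lipschitz_withZ c kf; rewrite gtr0_norm.
Qed.

Lemma Lip_gt0 f k x y : 0 <= k -> lipschitz_with k f -> f x != f y ->
  exists2 r, 0 < r & Lip f = r%:E.
Proof.
move=> k0 kf fxy.
have D0 : 0 < eucl_dist (set_val x) (set_val y).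
  by apply: eucl_dist_gt0; apply: contra_neq fxy => /val_inj ->.
pose q := `|f x - f y| / eucl_dist (set_val x) (set_val y).
have q0 : 0 < q by rewrite divr_gt0// normr_gt0 subr_eq0.
have h1 : (Lip f <= k%:E)%E by apply: ereal_inf_lbound; exists k.
have h2 : (q%:E <= Lip f)%E.
  apply/ereal_infP => _ [r [r0 rf] <-]; rewrite lee_fin ler_pdivrMr//.
have fin : Lip f \is a fin_num.
  rewrite ge0_fin_numE; first exact: le_lt_trans h1 (ltry _).
  by apply: le_trans h2; rewrite lee_fin ltW.
exists (fine (Lip f)); last by rewrite fineK.
by apply: (lt_le_trans q0); rewrite -lee_fin fineK.
Qed.

End BestLipschitzConstant.

Section Kernels.
Context {R : realType} {d : nat} {X A : set 'rV[R]_d}.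
Hypothesis convX : convex_points X.
Implicit Types (T : nat -> plTriangulation X A).

(** All conditions but the last determine the values at the vertices other than [v], which leaves
    the positive multiples of the hat. [Lip] is homogeneous, so its prescribed value fixes the
    factor. The hat is 1 at [v] and 0 at the point [a] of [A], whence its own best constant is
    positive. *)
Lemma is_kernelP T (L : nat -> R) n (v : vertex (cplx (T n))) (a : X) :
  0 < L n -> A (set_val a) -> ~ A (set_val (pt (T n) v)) ->
  exists2 c, 0 < c & forall f,
    is_kernel T L n (pt (T n) v) f <-> f = (fun x => c * hat (T n) v x).
Proof.
move=> Ln Aa Av; have [k k0 hk] := hat_lipschitz convX v.
have hv1 : hat (T n) v (pt (T n) v) = 1 by rewrite /hat bc_pt eqxx.
have [|r r0 hr] := @Lip_gt0 _ _ _ _ _ (pt (T n) v) a k0 hk.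
  by rewrite hv1 (hat_vanishes Av Aa) oner_neq0.
exists (L n / r) => [|f]; first exact: divr_gt0.
split=> [[fA flin f0 fv fL]|->].
- have fE : f = (fun x => f (pt (T n) v) * hat (T n) v x).
    apply: (linear_eq flin); first by apply: linearZ; exact: hat_linear.
    move=> w; rewrite /hat bc_pt; have [->|vw] := eqVneq v w; first by rewrite mulr1.
    rewrite mulr0; have [/fA//|/f0] := pt_free (T := T n) w; apply.
    by move=> /pt_inj wv; rewrite wv eqxx in vw.
  have := fL; rewrite {1}fE LipZ// hr -EFinM => -[e].
  by rewrite {1}fE -e mulfK// gt_eqF.
- have c0 : 0 < L n / r by exact: divr_gt0.
  split.
  + by move=> x Ax; rewrite (hat_vanishes Av Ax) mulr0.
  + by apply: linearZ; exact: hat_linear.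
  + move=> v' /free_verticesP[w -> _] wv; rewrite /hat bc_pt.
    by case: eqP => [vw|]; [rewrite vw in wv|rewrite mulr0].
  + by rewrite hv1 mulr1.
  + by rewrite LipZ// hr -EFinM divfK// gt_eqF.
Qed.

End Kernels.

(** * Passing from a triangulation to a refinement, and the interpolation error *)

Section Refinement.
Context {R : realType} {d : nat} {X A : set 'rV[R]_d}.
Implicit Types (T : plTriangulation X A) (f : X -> R).

(** The right-hand side consists of the barycentric coordinates of some point [y] of [s]. Expanding
    both points over vertices shows that [x] and [y] have the same position in space, so they
    coincide. *)
Lemma bc_refine T' T s' s x w : face s' -> face s ->
  simplex (T := T') s' `<=` simplex (T := T) s -> barycentric s' (bc T' x) ->
  bc T x w = \sum_(u <- s') bc T' x u * bc T (pt T' u) w.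
Proof.
move=> fs' fs sub sx.
have su u : u \in s' -> barycentric s (bc T (pt T' u)).
  by move=> us; apply/simplexP; apply: sub; apply/simplexP; exact: barycentric_pt.
pose a w := \sum_(u <- s') bc T' x u * bc T (pt T' u) w.
have sa : barycentric s a.
  split => [z|z zs|].
  - by apply: sumr_ge0 => u _; rewrite mulr_ge0// bc_ge0.
  - rewrite /a big1_seq// => u /= /su[_ h _].
    by rewrite h// mulr0.
  - rewrite exchange_big/=; have [_ _ <-] := sx.
    rewrite big_seq [RHS]big_seq; apply: eq_bigr => u us.
    by rewrite -mulr_sumr; have [_ _ ->] := su u us; rewrite mulr1.
have [y ya] := bary_point fs sa.
suff xy : x = y by rewrite [in LHS]xy ya.
apply: val_inj; change (set_val x = set_val y).
rewrite (bc_pl fs') // [RHS](bc_pl fs) ?(funext ya)//.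
under [RHS]eq_bigr do rewrite scaler_suml.
rewrite exchange_big/= big_seq [RHS]big_seq; apply: eq_bigr => u us.
under eq_bigr do rewrite -scalerA.
by rewrite -scaler_sumr -bc_pl//; exact: su.
Qed.

Lemma linear_on_refine T' T f : refines T' T -> linear_on T f -> linear_on T' f.
Proof.
move=> ref /linear_onP lf; apply/linear_onP => s' x fs' sx.
have [s fs sub] := ref s' fs'.
have su u : u \in s' -> barycentric s (bc T (pt T' u)).
  by move=> us; apply/simplexP; apply: sub; apply/simplexP; exact: barycentric_pt.
rewrite (lf s)//; last by apply/simplexP; apply: sub; apply/simplexP.
under eq_bigr do rewrite (bc_refine _ fs' fs sub sx) mulr_suml.
rewrite exchange_big/= big_seq [RHS]big_seq; apply: eq_bigr => u us.
by rewrite (lf s (pt T' u))//; [rewrite mulr_sumr; apply: eq_bigr => w _; rewrite mulrA|exact: su].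
Qed.

(* A vertex is an extreme point of every simplex of T, so it cannot lie in the
   relative interior of a simplex of positive dimension of T'. *)
Lemma vertex_refine T' T v : refines T' T -> exists v', pt T v = pt T' v'.
Proof.
move=> ref; set x := pt T v; have [s fs sub] := ref _ (carrier_face T' x).
have [h0 h1 h2] := carrierP T' x.
(* The coordinate at [v] is at most 1 at each vertex of the carrier and averages to 1 at [x], so it
   equals 1 at every vertex of positive weight. *)
have : \sum_(u <- carrier T' x) bc T' x u * (1 - bc T (pt T' u) v) == 0.
  under eq_bigr do rewrite mulrBr mulr1.
  rewrite sumrB h2 -(bc_refine _ (carrier_face T' x) fs sub (carrierP T' x)).
  by rewrite bc_pt eqxx subrr.
rewrite psumr_eq0; last by move=> u _; rewrite mulr_ge0 ?bc_ge0// subr_ge0 bc_le1.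
move=> /allP h.
have [u us xu] : exists2 u, u \in carrier T' x & bc T' x u != 0.
  apply: contrapT => no; move/eqP: h2; rewrite big1_seq ?(eq_sym 0) ?oner_eq0//= => u us.
  by apply: contrapT => /eqP xu; apply: no; exists u.
exists u; have := h u us; rewrite mulf_eq0 (negbTE xu)/= subr_eq0 => /eqP e.
by apply/esym/bc_eq1.
Qed.

Lemma free_vertices_refine T' T : refines T' T ->
  free_vertices T `<=` free_vertices T'.
Proof.
move=> ref x /free_verticesP[v -> Av]; have [v' e] := vertex_refine v ref.
by apply/free_verticesP; exists v' => //; rewrite -e.
Qed.

Lemma dist_le_mesh T s x y (e : R) : (mesh T <= e%:E)%E -> face s ->
  barycentric s (bc T x) -> barycentric s (bc T y) ->
  eucl_dist (set_val x) (set_val y) <= e.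
Proof.
move=> me fs sx sy; rewrite -lee_fin; apply: le_trans me.
apply: (@le_trans _ _ (eucl_diam (simplex s))); apply: ereal_sup_ubound.
  by exists (x, y) => //; split; apply/simplexP.
by exists s.
Qed.

(** Both values are averages with the same weights, of [f] at the vertices of the carrier and of the
    constant [f x]; each of these vertices is within the mesh of [x]. *)
Lemma interp_error T f k (e : R) x : (mesh T <= e%:E)%E -> 0 <= k ->
  lipschitz_with k f -> `|interp T f x - f x| <= k * e.
Proof.
move=> me k0 kf; have [h0 h1 h2] := carrierP T x.
have -> : f x = \sum_(v <- carrier T x) bc T x v * f x.
  by rewrite -mulr_suml h2 mul1r.
rewrite -sumrB (le_trans (ler_norm_sum _ _ _))//.
rewrite -[leRHS]mul1r -h2 mulr_suml !big_seq; apply: ler_sum => v vc.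
rewrite -mulrBr normrM ger0_norm// ler_wpM2l// (le_trans (kf _ _))//.
rewrite ler_wpM2l//; apply: (dist_le_mesh me (carrier_face T x)) (carrierP T x).
exact: barycentric_pt.
Qed.

End Refinement.

(** * Monotonicity along the nested sequence and infinitude of the set of free vertices *)

Section Nested.
Context {R : realType} {d : nat} {X A : set 'rV[R]_d}.
Variable T : nat -> plTriangulation X A.
Hypothesis hT : nested_triangulation T.

Lemma free_vertices_mono m n : (m <= n)%N ->
  free_vertices (T m) `<=` free_vertices (T n).
Proof.
move=> /subnK <-; elim: (n - m)%N => // k IH.
by rewrite addSn; apply: (subset_trans IH); apply: free_vertices_refine; exact: hT.1.
Qed.

Lemma linear_on_mono m n f : (m <= n)%N -> linear_on (T m) f -> linear_on (T n) f.
Proof.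
move=> /subnK <-; elim: (n - m)%N => // k IH /IH.
by rewrite addSn; apply: linear_on_refine; exact: hT.1.
Qed.

Lemma mesh_small (e : R) : 0 < e ->
  exists N, forall n, (N <= n)%N -> (mesh (T n) <= e%:E)%E.
Proof.
move=> e0; have /fine_cvgP[[N1 _ h1] /cvgrPdist_lt/(_ e e0)[N2 _ h2]] := hT.2.
exists (maxn N1 N2) => n; rewrite geq_max => /andP[/h1/= fn /h2/=].
rewrite sub0r normrN => h; rewrite -(fineK fn) lee_fin ltW//.
exact: le_lt_trans (ler_norm _) h.
Qed.

(** If the free vertices were finite in number, they would form a closed set together with [A]. A
    segment from a point outside [A] towards [A] starts with infinitely many points outside [A], so
    one of them avoids this closed set. At a fine level it has a nearby vertex that is neither free
    nor in [A], which is absurd. *)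
Lemma infinite_free_vertices : polyhedral_pair X A ->
  infinite_set (\bigcup_n free_vertices (T n)).
Proof.
move=> [polX [a0 Aa0] [AX nAX] [m [P [polP AE]]]] finV.
have convX := polyhedron_convex polX.
have [x0 [Xx0 nAx0]] : exists x, X x /\ ~ A x.
  by apply: contrapT => h; apply: nAX => x Xx; apply: contrapT => nA; apply: h; exists x.
have clA : closed A.
  rewrite AE; apply: closed_bigcup; first exact: finite_finset.
  by move=> i _; apply: polyhedron_closed; have [] := polP i.
pose x : X := SigSub (mem_set Xx0).
pose a : X := SigSub (mem_set (AX _ Aa0)).
pose z := segment_point convX x a.
have cz : continuous ((set_val : X -> 'rV[R]_d) \o z).
  move=> t; apply: continuous_comp; first exact: segment_point_continuous.
  exact: initial_continuous.
have oz : open (((set_val : X -> 'rV[R]_d) \o z) @^-1` ~` A).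
  by apply: open_comp; [move=> t _; exact: cz|exact: closed_openC].
have z0 : (((set_val : X -> 'rV[R]_d) \o z) @^-1` ~` A) 0.
  by rewrite /= /z segment_point0.
have := open_nbhs_nbhs (conj oz z0) => /nbhs_ballP[e /= e0 he].
(* Distinct parameters strictly below both 1 and [e]; the denominator starts at 2 to make the
   inequality strict. *)
pose t n : R := Num.min 1 e / n.+2%:R.
have t0 n : 0 < t n by rewrite divr_gt0// lt_min ltr01.
have tlt n : t n < Num.min 1 e.
  by rewrite ltr_pdivrMr// ltr_pMr ?ltr1n// lt_min ltr01.
have t01 n : 0 <= t n <= 1.
  by rewrite ltW//=; have := tlt n; rewrite lt_min => /andP[/ltW].
have zt n : set_val (z (t n)) = set_val x + t n *: (set_val a - set_val x).
  rewrite /z segment_pointE clamp_id// scalerBl scale1r scalerBr.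
  by rewrite addrAC addrA.
have tinj : injective t.
  move=> i j /(mulfI (lt0r_neq0 _)); rewrite lt_min ltr01 e0 => /(_ isT).
  by move=> /invr_inj/eqP; rewrite eqr_nat => /eqP[].
have zinj : injective (z \o t).
  move=> i j /= /(congr1 set_val); rewrite !zt => /addrI/eqP.
  rewrite -subr_eq0 -scalerBl scaler_eq0 !subr_eq0 => /orP[/eqP/tinj//|/eqP ax].
  by exfalso; apply: nAx0; rewrite -[x0]/(set_val x) -ax.
have [n nV] : exists n, ~ (\bigcup_n free_vertices (T n)) (z (t n)).
  apply: contrapT => h; apply: infinite_nat.
  apply: sub_finite_set (finite_preimage (in2W zinj) finV) => n _.
  by apply: contrapT => nV; apply: h; exists n.
pose B := [set set_val y | y in \bigcup_n free_vertices (T n)] `|` A.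
have clB : closed B.
  apply: closedU => //; apply: (accessible_finite_set_closed.1 _).
    by apply: hausdorff_accessible; exact: norm_hausdorff.
  exact: finite_image.
have nB : (~` B) (set_val (z (t n))).
  move=> [[y Vy yz]|]; first by apply: nV; rewrite -(val_inj yz).
  apply: he; rewrite /ball /= sub0r normrN gtr0_norm//.
  by have := tlt n; rewrite lt_min => /andP[].
have := open_nbhs_nbhs (conj (closed_openC clB) nB).
move=> /nbhs_normP[r /= r0 hr].
have [N /(_ _ (leqnn N)) hN] := mesh_small (divr_gt0 r0 (ltr0n R 2)).
set y := z (t n) in nV nB hr.
have [w wc] : exists w, w \in carrier (T N) y.
  by apply/fset0Pn; apply: face_neq0; exact: carrier_face.
have : (~` B) (set_val (pt (T N) w)).
  apply: hr => /=; apply: (le_lt_trans (norm_le_eucl_dist _ _)).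
  have := dist_le_mesh hN (carrier_face (T N) y) (carrierP (T N) y) (barycentric_pt wc).
  move=> /le_lt_trans; apply; lra.
apply; have [|fw] := pt_free (T := T N) w; first by right.
by left; exists (pt (T N) w) => //; exists N.
Qed.

End Nested.

(* Greedily enumerate an element of least rank among those not yet listed. *)
Lemma ranked_enumeration (T : choiceType) (P : set T) (rk : T -> nat) :
  infinite_set P -> (forall k, finite_set [set x | P x /\ (rk x <= k)%N]) ->
  exists e : nat -> T, [/\ injective e, forall n, P (e n),
    forall x, P x -> exists n, e n = x &
    forall m n, (m <= n)%N -> (rk (e m) <= rk (e n))%N].
Proof.
move=> infP fink.
have /choice[pick pickP] (s : seq T) : exists x, [/\ P x, x \notin s &
    forall y, P y -> y \notin s -> (rk x <= rk y)%N].
  have [y [Py ys]] : exists y, P y /\ y \notin s.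
    have /infinite_setN0[y [Py /negP ys]] := infinite_setD infP (finite_seq s).
    by exists y.
  have exk : exists k, `[< exists x, [/\ P x, x \notin s & rk x = k] >].
    by exists (rk y); apply/asboolP; exists y.
  case: (ex_minnP exk) => k /asboolP[x [Px xs <-]] mink.
  by exists x; split => // z Pz zs; apply: mink; apply/asboolP; exists z.
pose l n := iter n (fun s => rcons s (pick s)) [::].
pose e n := pick (l n).
have el m n : (m < n)%N -> e m \in l n.
  elim: n => // n IH; rewrite ltnS leq_eqVlt /l /= mem_rcons inE => /orP[/eqP ->|/IH ->].
    by rewrite eqxx.
  by rewrite orbT.
have le n x : x \in l n -> exists m, e m = x.
  elim: n => // n IH; rewrite /l /= mem_rcons inE => /orP[/eqP ->|/IH//].
  by exists n.
have einj : injective e.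
  move=> m n emn; case: (ltngtP m n) => // /el.
    by rewrite emn; have [_ /negP] := pickP (l n).
  by rewrite -emn; have [_ /negP] := pickP (l m).
have eP n : P (e n) by have [] := pickP (l n).
exists e; split => //.
(* An [x] that is never listed would bound the rank of every [e n] by its own, leaving only finitely
   many possible values for the injective [e]. *)
- move=> x Px; apply: contrapT => nx; apply: infinite_nat.
  apply: sub_finite_set (finite_preimage (in2W einj) (fink (rk x))) => n _ /=.
  split => //; have [_ _] := pickP (l n); apply => //.
  by apply/negP => /le[m em]; apply: nx; exists m.
- move=> m n /subnK <-; elim: (n - m)%N => // k IH; apply: (leq_trans IH).
  rewrite addSn; have [_ _] := pickP (l (k + m)%N); apply => //.
  have [_ + _] := pickP (l (k + m).+1).
  by rewrite {2}/l /= mem_rcons inE negb_or => /andP[].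
Qed.

(** * Levels and ranks of free vertices *)

Section Levels.
Context {R : realType} {d : nat} {X A : set 'rV[R]_d}.
Variable T : nat -> plTriangulation X A.
Hypothesis hT : nested_triangulation T.

(** The least level at which [x] is a free vertex, with default 0 at points that never become
    one. *)
Definition level (x : X) : nat :=
  xget 0%N [set n | free_vertices (T n) x /\
    forall m, free_vertices (T m) x -> (n <= m)%N].

Lemma levelP n x : free_vertices (T n) x ->
  free_vertices (T (level x)) x /\ (level x <= n)%N.
Proof.
move=> xn; rewrite /level; case: xgetP => [k _ [h1 h2]|no]; first by split => //; exact: h2.
have exk : exists k, `[< free_vertices (T k) x >] by exists n; apply/asboolP.
case: (ex_minnP exk) => k /asboolP xk mink.
by exfalso; apply: (no k); split => // m xm; apply: mink; apply/asboolP.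
Qed.

Lemma free_vertices_level n x : free_vertices (T (level x)) x ->
  (level x <= n)%N -> free_vertices (T n) x.
Proof. by move=> xl ln; exact: (free_vertices_mono hT ln). Qed.

Lemma new_verticesP n x :
  new_vertices T n x <-> free_vertices (T n) x /\ level x = n.
Proof.
split=> [|[xn ln]].
  case: n => [x0|m [xm nxm]]; split => //.
  - by apply/eqP; rewrite -leqn0; exact: (levelP x0).2.
  - have [xl lx] := levelP xm; apply/eqP; rewrite eqn_leq lx ltnNge.
    by apply/negP => /(free_vertices_level xl).
case: n xn ln => [//|m xm ln]; split => // /levelP[_].
by rewrite ln ltnn.
Qed.

Definition rank x := maxn (level x) (Num.truncn `|set_val x|).

(** Such points are vertices of the single triangulation [T k], of norm at most [k.+1]. *)
Lemma finite_rank k : closed X -> finite_set [set x |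
  (\bigcup_n free_vertices (T n)) x /\ (rank x <= k)%N].
Proof.
move=> clX.
apply: sub_finite_set
  (finite_image (pt (T k)) (finite_bounded_vertices (T k) k.+1%:R clX)).
move=> x [[n _ xn]]; rewrite /rank geq_max => /andP[lx nx].
have [v xv _] := (free_verticesP _ _).1 (free_vertices_level (levelP xn).1 lx).
exists v => //=; rewrite -xv; have /andP[_ /ltW h] := truncn_itv (normr_ge0 (set_val x)).
by rewrite (le_trans h)// ler_nat.
Qed.

Lemma rank_level x : (level x <= rank x)%N.
Proof. exact: leq_maxl. Qed.

Lemma rank_le x k (K : R) : (level x <= k)%N -> `|set_val x| <= K -> K <= k%:R ->
  (rank x <= k)%N.
Proof.
move=> lk xK Kk; rewrite /rank geq_max lk /= -(ler_nat R).
have /andP[h _] := truncn_itv (normr_ge0 (set_val x)).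
by rewrite (le_trans h)// (le_trans xK).
Qed.

End Levels.

(** * Supports and bounds of interpolated functions *)

Section SupportedFunctions.
Context {R : realType} {d : nat} {X A : set 'rV[R]_d}.

Lemma lipc_support_bounded (f : lipc X A) :
  exists M, forall x, lipc_fun f x != 0 -> `|set_val x| <= M.
Proof.
case: f => f /= /asboolP[_ cf _].
have /compact_bounded[M [_ MK]] :
    compact ((set_val : X -> 'rV[R]_d) @` closure [set x : X | f x != 0]).
  apply: continuous_compact cf; apply: continuous_subspaceT.
  exact: initial_continuous.
exists (`|M| + 1) => x fx; apply: (MK (`|M| + 1)).
  by rewrite (le_lt_trans (ler_norm M))// ltrDl.
by exists x => //; exact: subset_closure.
Qed.

Lemma finite_support_vertices (T : plTriangulation X A) (f : X -> R) M :
  closed X -> (forall x, f x != 0 -> `|set_val x| <= M) ->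
  finite_set [set v | f (pt T v) != 0].
Proof.
move=> clX fM; apply: sub_finite_set (finite_bounded_vertices T M clX) => v.
exact: fM.
Qed.

Lemma interp_bound (T : plTriangulation X A) (f : X -> R) (C : R) x :
  (forall v, `|f (pt T v)| <= C) -> `|interp T f x| <= C.
Proof.
move=> fC; have [h0 _ h1] := carrierP T x.
rewrite (le_trans (ler_norm_sum _ _ _))// -[leRHS]mul1r -h1 mulr_suml.
by apply: ler_sum => v _; rewrite normrM ger0_norm// ler_wpM2l.
Qed.

Lemma interp_neq0 (T : plTriangulation X A) (f : X -> R) x :
  interp T f x != 0 -> exists2 v, v \in carrier T x & f (pt T v) != 0.
Proof.
apply: contra_neqP => h; apply: big1_seq => v /= vc.
have [->|fv] := eqVneq (f (pt T v)) 0; first by rewrite mulr0.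
by exfalso; apply: h; exists v.
Qed.

Lemma interp_sum (T : plTriangulation X A) (I : Type) (r : seq I) (P : pred I)
    (c : I -> R) (F : I -> X -> R) x :
  interp T (fun y => \sum_(i <- r | P i) c i * F i y) x =
  \sum_(i <- r | P i) c i * interp T (F i) x.
Proof.
rewrite /interp; under eq_bigr do rewrite mulr_sumr.
rewrite exchange_big; apply: eq_bigr => i _ /=; rewrite mulr_sumr.
by apply: eq_bigr => v _; rewrite mulrCA.
Qed.

End SupportedFunctions.

(** * Expansion of a function in the enumerated hats *)

Section HatBasis.
Context {R : realType} {d : nat} {X A : set 'rV[R]_d}.
Variable T : nat -> plTriangulation X A.
Hypothesis hT : nested_triangulation T.
Variable p : nat -> X.
Hypothesis pinj : injective p.
Hypothesis pfree : forall i, (\bigcup_n free_vertices (T n)) (p i).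
Hypothesis psurj : forall x, (\bigcup_n free_vertices (T n)) x ->
  exists i, p i = x.
Hypothesis prank : forall i j, (i <= j)%N -> (rank T (p i) <= rank T (p j))%N.
Implicit Types (f : X -> R) (i j m n M N : nat).

Local Notation lev i := (level T (p i)).

(* p enumerates V; basis_hat i is the unnormalised kernel of p i, described by
   its values at vertices so that no vertex of the complex T (lev i), whose type
   depends on i, has to be chosen. *)
Definition basis_hat i : X -> R := interp (T (lev i)) (fun y => (y == p i)%:R).

Lemma pfree_level i : free_vertices (T (lev i)) (p i).
Proof. by have [n _ /levelP[]] := pfree i. Qed.

Lemma p_notA i : ~ A (set_val (p i)).
Proof. by have /free_verticesP[v pv Av] := pfree_level i; rewrite pv. Qed.

Lemma basis_hatE i :
  exists2 v, p i = pt (T (lev i)) v & basis_hat i = hat (T (lev i)) v.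
Proof.
have /free_verticesP[v pv _] := pfree_level i; exists v => //.
apply: linear_eq; [exact: interp_linear|exact: hat_linear|] => w.
rewrite /basis_hat interp_pt /hat bc_pt; congr (_%:R); congr nat_of_bool.
by apply/eqP/eqP => [e|<-//]; apply: (@pt_inj _ _ _ _ (T (lev i))); rewrite -pv.
Qed.

Lemma basis_hat_vanishes i : vanishes_on_A (A := A) (basis_hat i).
Proof.
apply: interp_vanishes => y Ay; case: eqP => // ypi.
by exfalso; apply: (@p_notA i); rewrite -ypi.
Qed.

(** As levels are nested, [p i] is still a vertex of [T (lev j)], where the hat is read off
    directly. This triangularity yields both the coefficients and their uniqueness. *)
Lemma basis_hat_p i j : (lev i <= lev j)%N -> basis_hat j (p i) = (i == j)%:R.
Proof.
move=> ij; have := free_vertices_level hT (pfree_level i) ij.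
move=> /free_verticesP[w pw _]; rewrite /basis_hat pw interp_pt -pw.
by rewrite (inj_eq pinj).
Qed.

Lemma delta_sum (c : nat -> R) M n j :
  \sum_(0 <= i < M | lev i == n) c i * (p j == p i)%:R =
  if (j < M)%N && (lev j == n) then c j else 0.
Proof.
rewrite big_mkcond (eq_bigr (fun i => if i == j then
    (if lev j == n then c j else 0) else 0)); last first.
  move=> i _; have [->|ij] := eqVneq i j; first by rewrite eqxx mulr1.
  by rewrite (inj_eq pinj) [j == i]eq_sym (negbTE ij) mulr0 if_same.
by rewrite -big_mkcond big_nat1_eq/=; case: (j < M)%N.
Qed.

Lemma level_sum (c : nat -> R) M n x :
  \sum_(0 <= i < M | lev i == n) c i * basis_hat i x =
  interp (T n) (fun y => \sum_(0 <= i < M | lev i == n) c i * (y == p i)%:R) x.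
Proof. by rewrite interp_sum; apply: eq_bigr => i /eqP <-. Qed.

Lemma delta_sum_A (c : nat -> R) M n y : A (set_val y) ->
  \sum_(0 <= i < M | lev i == n) c i * (y == p i)%:R = 0.
Proof.
move=> Ay; apply: big1 => i _; case: eqP => [ypi|]; last by rewrite mulr0.
by exfalso; apply: (@p_notA i); rewrite -ypi.
Qed.

Definition prev_interp f n : X -> R :=
  if n is m.+1 then interp (T m) f else fun=> 0.

Definition coef f i : R := f (p i) - prev_interp f (lev i) (p i).

(** Both sides are linear on [T N], so vertices suffice. In [A] everything vanishes; at a vertex of
    level [N] the value is the coefficient by definition; at an older vertex both interpolations
    equal [f] and the hats of level [N] vanish. *)
Lemma level_sum_coef f M N : vanishes_on_A (A := A) f ->
  (forall i, lev i = N -> coef f i != 0 -> (i < M)%N) ->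
  (fun x => \sum_(0 <= i < M | lev i == N) coef f i * basis_hat i x) =
  (fun x => interp (T N) f x - prev_interp f N x).
Proof.
move=> fA cM; under eq_fun do rewrite level_sum.
have lin_prev : linear_on (T N) (prev_interp f N).
  case: N {cM} => [|n] /=; last first.
    by apply: (linear_on_mono hT (leqnSn n)); exact: interp_linear.
  apply/linear_onP => s x _ _; rewrite big1// => v _; exact: mulr0.
apply: (@linear_eq _ _ _ _ (T N)); first exact: interp_linear.
  by apply: linearB => //; exact: interp_linear.
move=> w; rewrite !interp_pt; have [Aw|fw] := pt_free (T := T N) w.
  rewrite delta_sum_A// fA//; case: {cM lin_prev} N w Aw => [|n] w Aw /=; first by rewrite subr0.
  by rewrite interp_vanishes// subr0.
have [|j pj] := psurj (x := pt (T N) w); first by exists N.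
have := levelP fw; rewrite -pj => -[xj]; rewrite leq_eqVlt delta_sum => /orP[/eqP lj|lj].
  rewrite lj eqxx andbT /coef lj; case: ltnP => // Mj.
  apply/esym/eqP; move: Mj; rewrite leqNgt; apply: contraNT => cj.
  by apply: cM => //; rewrite /coef lj.
rewrite (ltn_eqF lj) andbF.
case: {cM lin_prev} N w fw pj lj => // n w fw pj lj /=.
have /free_verticesP[u pu _] := free_vertices_level hT (pfree_level j) (n := n) lj.
by rewrite pu interp_pt subrr.
Qed.

(** Summing over the levels, the successive differences of interpolations telescope. *)
Lemma partial_sum_coef f M N x : vanishes_on_A (A := A) f ->
  (forall i, (lev i <= N)%N -> coef f i != 0 -> (i < M)%N) ->
  \sum_(0 <= i < M | (lev i <= N)%N) coef f i * basis_hat i x = interp (T N) f x.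
Proof.
move=> fA; have step n : (forall i, (lev i <= n)%N -> coef f i != 0 -> (i < M)%N) ->
    \sum_(0 <= i < M | lev i == n) coef f i * basis_hat i x =
    interp (T n) f x - prev_interp f n x.
  move=> cM; have := @level_sum_coef f M n fA; move=> /(_ _)/(congr1 (@^~ x))/=; apply.
  by move=> i li; apply: cM; rewrite li.
elim: N => [|N IH] cM.
  by under eq_bigl do rewrite leqn0; rewrite step//= subr0.
rewrite (bigID (fun i => lev i == N.+1))/=.
rewrite (eq_bigl (fun i => lev i == N.+1)); last first.
  by move=> i /=; case: eqP => [->|_]; rewrite ?leqnn ?andbF.
rewrite step// [X in _ + X](_ : _ = interp (T N) f x) ?subrK//.
rewrite -IH => [|i li]; last by apply: cM; exact: leqW.
by apply: eq_bigl => i; rewrite [in RHS]leqNgt leq_eqVlt; case: ltngtP.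
Qed.

(** Up to level [N] only finitely many interpolations occur, each of bounded support. Beyond it the
    mesh is at most 1, so a vertex where the previous interpolation is nonzero lies within distance
    1 of a point where [f] is nonzero. *)
Lemma coef_support_bounded (f : lipc X A) : convex_points X -> closed X ->
  exists K, forall i, coef (lipc_fun f) i != 0 -> `|set_val (p i)| <= K.
Proof.
move=> convX clX; have [B BP] := lipc_support_bounded f.
have /choice[K KP] n : exists K, forall x,
    prev_interp (lipc_fun f) n x != 0 -> `|set_val x| <= K.
  case: n => [|n] /=; first by exists 0 => x; rewrite eqxx.
  by apply: interp_support_bounded => //; exact: (finite_support_vertices _ clX BP).
have [N hN] := mesh_small hT (ltr01 : 0 < 1 :> R).
exists (\sum_(n < N.+1) `|K n| + (`|B| + 1)) => i ci.
have S0 : 0 <= \sum_(n < N.+1) `|K n| by exact: sumr_ge0.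
have [fi|/BP fi] := eqVneq (lipc_fun f (p i)) 0; last first.
  by rewrite (le_trans fi)// (le_trans (ler_norm B))// addrCA lerDl addr_ge0.
have : prev_interp (lipc_fun f) (lev i) (p i) != 0.
  by apply: contraNneq ci => e; rewrite /coef fi e subr0.
have [li|] := leqP (lev i) N.
  move=> /KP h; rewrite (le_trans h)// (le_trans (ler_norm _))//.
  rewrite (bigD1 (Ordinal (li : (lev i < N.+1)%N)))//= -addrA lerDl.
  by rewrite !addr_ge0// sumr_ge0.
case: (lev i) => // m; rewrite ltnS => Nm /= /interp_neq0[v vc /BP vB].
rewrite -[set_val (p i)](subrK (set_val (pt (T m) v))).
rewrite (le_trans (ler_normD _ _))// addrC -[leLHS]add0r lerD// lerD//.
  exact: (le_trans vB (ler_norm B)).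
apply: (le_trans (norm_le_eucl_dist _ _)).
exact: (dist_le_mesh (hN m Nm) (carrier_face (T m) (p i)) (carrierP _ _) (barycentric_pt vc)).
Qed.

Lemma rank_unbounded : closed X -> forall k, exists i, (k < rank T (p i))%N.
Proof.
move=> clX k; apply: contrapT => h; apply: infinite_nat.
apply: sub_finite_set (finite_preimage (in2W pinj) (finite_rank hT k clX)) => i _ /=.
by split => //; rewrite leqNgt; apply/negP => ki; apply: h; exists i.
Qed.

(* Once the rank of p M exceeds the size of the support, the coefficients of
   the first M + 1 terms are those of all levels at most N, where N + 1 is that
   rank, together with some of level N + 1. *)
Lemma coef_sum_cvg (f : lipc X A) (e : R) : convex_points X -> closed X ->
  0 < e -> exists N0, forall M, (N0 <= M)%N -> forall x,
  `|lipc_fun f x - \sum_(0 <= i < M) coef (lipc_fun f) i * basis_hat i x| <= e.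
Proof.
move=> convX clX e0.
have [k [k0 kf]] : exists k, 0 <= k /\ lipschitz_with k (lipc_fun f).
  case: f => f /= /asboolP[[k kf] _ _]; exists `|k|; split => // x y.
  by rewrite (le_trans (kf x y))// ler_wpM2r ?eucl_dist_ge0// ler_norm.
have fA : vanishes_on_A (A := A) (lipc_fun f) by case: (f) => g /= /asboolP[].
have [K KP] := coef_support_bounded f convX clX.
(* The interpolation error [k * h] will be paid twice; adding 1 to [k] avoids a zero denominator. *)
pose h := e / (2 * (k + 1)).
have k1 : 0 < k + 1 by rewrite ltr_wpDl.
have h0 : 0 < h by rewrite divr_gt0// mulr_gt0.
have khe : k * h + k * h <= e.
  have hh : (k + 1) * h = e / 2 by rewrite /h; field; rewrite gt_eqF.
  by move: hh; rewrite mulrDl mul1r; lra.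
have [N1 hN1] := mesh_small hT h0.
pose K' := maxn N1 (Num.truncn `|K|).+1.
have KK' : K <= K'%:R.
  have /andP[_ /ltW hK] := truncn_itv (normr_ge0 K).
  by rewrite (le_trans (ler_norm K))// (le_trans hK)// ler_nat leq_maxr.
have [M0 hM0] := rank_unbounded clX K'.
(* A positive number of terms guarantees a last index [M], whose rank [N.+1] controls the levels
   that are complete. *)
exists M0.+1 => -[//|M]; rewrite ltnS => M0M x.
have : (K' < rank T (p M))%N by apply: (leq_trans hM0); exact: prank.
case Er : (rank T (p M)) => [//|N]; rewrite ltnS => K'N.
have levM i : (i < M.+1)%N -> (lev i <= N.+1)%N.
  by rewrite ltnS -Er => /prank; apply: leq_trans; exact: rank_level.
have coefM i : (lev i <= N)%N -> coef (lipc_fun f) i != 0 -> (i < M.+1)%N.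
  move=> li /KP pK; rewrite ltnS leqNgt; apply/negP => /ltnW/prank.
  have := rank_le li pK (le_trans KK' _); rewrite ler_nat => /(_ K'N).
  by rewrite Er => h1 h2; have := leq_trans h2 h1; rewrite ltnn.
have N1N : (N1 <= N)%N by apply: leq_trans K'N; exact: leq_maxl.
rewrite (bigID (fun i => (lev i <= N)%N))/= partial_sum_coef//.
rewrite opprD addrA (le_trans (ler_normB _ _))// (le_trans _ khe)//.
apply: lerD.
  by rewrite distrC; exact: (interp_error _ (hN1 N N1N)).
rewrite big_nat_cond (eq_bigl (fun i => (0 <= i < M.+1)%N && (lev i == N.+1))); last first.
  move=> i /=; case: ltnP => //= iM; rewrite -ltnNge eqn_leq.
  by rewrite levM.
(* What remains interpolates coefficients of level [N.+1], and each of these is an error of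
   interpolation on [T N] at a vertex. *)
rewrite -big_nat_cond level_sum; apply: interp_bound => v.
have kh0 : 0 <= k * h by rewrite mulr_ge0// ltW.
have [Av|fv] := pt_free (T := T N.+1) v; first by rewrite delta_sum_A// normr0.
have [|j <-] := psurj (x := pt (T N.+1) v); first by exists N.+1.
rewrite delta_sum; case: ifP => [/andP[_ /eqP lj]|]; last by rewrite normr0.
by rewrite /coef lj /= distrC; exact: (interp_error _ (hN1 N N1N)).
Qed.

(** By induction on the level: at [p i], terms of lower level have zero coefficient, and all other
    hats except that of [i] vanish, so the partial sums are eventually [a i]. *)
Lemma coef_unique (a : nat -> R) :
  (forall i, (fun M => \sum_(0 <= j < M) a j * basis_hat j (p i)) @ \oo --> (0 : R)) ->
  forall i, a i = 0.
Proof.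
move=> ha i; have [n] := ubnP (lev i); elim: n i => // n IH i li.
have : (fun M => \sum_(0 <= j < M) a j * basis_hat j (p i)) @ \oo --> a i.
  apply: cvg_near_cst; exists i.+1 => // M /= iM.
  apply/eqP; rewrite (bigD1_seq i) ?iota_uniq ?mem_index_iota//=.
  rewrite basis_hat_p// eqxx mulr1 big1 ?addr0// => j ji.
  have [lji|lij] := ltnP (lev j) (lev i).
    by rewrite IH ?mul0r// (leq_trans lji).
  by rewrite basis_hat_p// eq_sym (negbTE ji) mulr0.
by move=> /(cvg_unique (@norm_hausdorff _ R))/(_ (ha i)).
Qed.

End HatBasis.

(** * Evaluation of series in the normed space, and the Schauder basis *)

Section LipcBasis.
Context {R : realType} {d : nat} {X A : set 'rV[R]_d}.
Implicit Types (f : lipc X A).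

Lemma lipc_fun_sum (I : Type) (r : seq I) (a : I -> R) (e : I -> lipc X A) x :
  lipc_fun (\sum_(i <- r) a i *: e i) x = \sum_(i <- r) a i * lipc_fun (e i) x.
Proof.
elim: r => [|i r IH]; first by rewrite !big_nil.
by rewrite !big_cons -IH.
Qed.

Lemma lipc_cvg_eval (u : nat -> lipc X A) f x : u @ \oo --> f ->
  (fun n => lipc_fun (u n) x) @ \oo --> lipc_fun f x.
Proof.
move=> /cvgrPdist_le uf; apply/cvgrPdist_le => e e0.
near=> n; have h : `|f - u n| <= e by near: n; exact: uf.
exact: le_trans (sup_normP (f - u n) x) h.
Unshelve. all: by end_near.
Qed.

End LipcBasis.

Theorem theorem4p4 (R : realType) (d : nat) (X A : set 'rV[R]_d)
    (T : nat -> plTriangulation X A) (L : nat -> R) (l : R)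
    (hXA : polyhedral_pair X A)
    (hT : nested_triangulation T)
    (hL : forall n, 0 < L n)
    (hsum : series L @ \oo --> l) :
  exists e : nat -> lipc X A,
    set_bij [set: nat] (kernels T L) (fun i => lipc_fun (e i)) /\
    schauder_basis e.
Proof.
have [polX [a0 Aa0] [AX _] _] := hXA.
have clX := polyhedron_closed polX; have convX := polyhedron_convex polX.
pose a : X := SigSub (mem_set (AX _ Aa0)).
have [p [pinj pfree psurj prank]] :=
  ranked_enumeration (infinite_free_vertices hT hXA) (fun k => finite_rank hT k clX).
have /choice[c cP] i : exists c : R, 0 < c /\ forall f,
    is_kernel T L (level T (p i)) (p i) f <->
    f = (fun x => c * basis_hat T p i x).
  have [v pv ->] := basis_hatE pfree i.
  have [|c c0 cP] := @is_kernelP _ _ _ _ convX T L _ v a (hL _) Aa0.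
    by rewrite -pv; exact: (p_notA pfree).
  by rewrite -pv in cP; exists c.
pose g i (x : X) : R^o := c i * basis_hat T p i x.
have gP i : g i \in @lipc_pred R d X A.
  apply/asboolP; split.
  - have [v _ hv] := basis_hatE pfree i; have [k _ kl] := hat_lipschitz convX v.
    by exists (`|c i| * k); rewrite /g hv; exact: lipschitz_withZ.
  - have [v _ hv] := basis_hatE pfree i; have [M MP] := hat_support_bounded v.
    apply: (@bounded_compactly_supported _ _ _ _ M clX) => x.
    by rewrite /g hv mulf_eq0 negb_or => /andP[_]; exact: MP.
  - by move=> x Ax; rewrite /g basis_hat_vanishes ?mulr0.
pose e i : lipc X A := MkLipc (gP i).
have c0 i : c i != 0 by rewrite gt_eqF// (cP i).1.
have series_eval (u : nat -> R) M x :
    lipc_fun ([series u i *: e i]_i M) x =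
    \sum_(0 <= i < M) u i * c i * basis_hat T p i x.
  by rewrite lipc_fun_sum; apply: eq_bigr => i _; rewrite mulrA.
exists e; split.
  split.
  - move=> i _; exists (level T (p i)); exists (p i).
      by apply/(new_verticesP hT); split => //; exact: pfree_level.
    exact/(cP i).2.
  - move=> i j _ _ /= /(congr1 (@^~ _)) gij.
    (* At the vertex of smaller level the other hat vanishes unless the indices agree, while its own
       kernel is positive there. *)
    wlog lij : i j gij / (level T (p i) <= level T (p j))%N.
      by move=> h; have [/h|/ltnW/h h'] := leqP (level T (p i)) (level T (p j));
         [exact|apply/esym/h' => x; rewrite gij].
    have := gij (p i); rewrite /g !(basis_hat_p hT pinj pfree)// eqxx mulr1.
    by case: eqP => // _ /eqP; rewrite mulr0 (negbTE (c0 i)).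
  - move=> f [n [v /(new_verticesP hT)[fv lv] kf]].
    have [|i pi] := psurj v; first by exists n.
    by exists i => //=; apply/esym/(cP i).2; rewrite pi lv.
move=> w.
have series_uniq (u u' : nat -> R) : [series u i *: e i]_i @ \oo --> w ->
    [series u' i *: e i]_i @ \oo --> w -> u = u'.
  move=> uw u'w; apply/funext => i; apply/eqP; rewrite -subr_eq0.
  have /eqP : (u i - u' i) * c i = 0; last by rewrite mulf_eq0 (negbTE (c0 i)) orbF.
  apply: (coef_unique hT pinj pfree (a := fun i => (u i - u' i) * c i)) => j.
  rewrite -[X in _ --> X](subrr (lipc_fun w (p j))).
  have -> : (fun M => \sum_(0 <= k < M) (u k - u' k) * c k * basis_hat T p k (p j)) =
      (fun M => lipc_fun ([series u i *: e i]_i M) (p j) -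
                lipc_fun ([series u' i *: e i]_i M) (p j)).
    apply/funext => M; rewrite !series_eval -sumrB; apply: eq_bigr => k _.
    by rewrite !mulrBl.
  exact: (cvgB (lipc_cvg_eval uw) (lipc_cvg_eval u'w)).
(* The coefficients were computed for unnormalised hats, hence the division by [c i]. *)
suff cvg_coef : [series (coef T p (lipc_fun w) i / c i) *: e i]_i @ \oo --> w.
  by exists (fun i => coef T p (lipc_fun w) i / c i); split => // u; exact: series_uniq.
apply/cvgrPdist_le => r r0.
have [N0 hN0] := coef_sum_cvg hT pinj pfree psurj prank w convX clX r0.
exists N0 => // M /= N0M; apply: sup_norm_le => [|x]; first exact: ltW.
rewrite (_ : lipc_fun _ x = lipc_fun w x -
    lipc_fun ([series (coef T p (lipc_fun w) i / c i) *: e i]_i M) x)//.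
by rewrite series_eval; under eq_bigr do rewrite divfK//; exact: hN0.
Qed.
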